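(* Let $q$ be a prime and $k$ a natural number. Let $\mathcal{S}_{q,k}$ be the collection of all $k$-element subsets of $\mathbb{Z}$ that contain a $q^{th}$ power modulo almost every prime. Then: (1) The additive subset density of $\mathcal{S}_{q,k}$ is zero. More specifically, there is a positive constant $a_{q,k}$ depending only on $q$ and $k$ such that for every $N\in\mathbb{N}$, the number of $k$-element subsets of $\{-N,\ldots,-1,0,1,\ldots,N\}$ that contain a $q^{th}$ power modulo almost every prime is at most $a_{q,k}N^{k-(1-\frac{1}{q})}$. (2) The multiplicative subset density of $\mathcal{S}_{q,k}$ is zero. More specifically, there is a positive constant $m_{q,k}$ depending only on $q$ and $k$ such that for every $N\in\mathbb{N}$, the number of $k$-element subsets of $\{\pm p_1^{e_1}p_2^{e_2}\cdots p_N^{e_N} : 0\le e_1,\ldots,e_N\le N\}$ that contain a $q^{th}$ power modulo almost every prime is at most $m_{q,k}\frac{N^{Nk}}{q^N}$.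
   Context: Let $\mathbb{P}=\{p_1<p_2<\cdots\}$ be the set of primes ordered by size. For $S\subseteq\mathbb{P}$, its relative density is $d_{\mathbb{P}}(S)=\lim_{N\to\infty}\frac{|S\cap\{1,\ldots,N\}|}{|\mathbb{P}\cap\{1,\ldots,N\}|}$ when the limit exists. An integer $a$ is a $q^{th}$ power modulo a prime $p$ if $a\equiv x^q \pmod p$ for some integer $x$. A set $A\subseteq\mathbb{Z}$ contains a $q^{th}$ power modulo almost every prime if the set $\{p\in\mathbb{P}: A \text{ contains a } q^{th}\text{ power modulo } p\}$ has relative density $1$ in $\mathbb{P}$. Let $[N]=\{-N,\ldots,-1,0,1,\ldots,N\}$ and $[N]^{\times}=\{\pm p_1^{e_1}p_2^{e_2}\cdots p_N^{e_N}: 0\le e_1,\ldots,e_N\le N\}$ (a set with $2(N+1)^N$ elements). For a set $X$, $\mathfrak{P}_k(X)$ denotes the collection of all $k$-element subsets of $X$. The additive subset density of a collection $\mathcal{S}$ of $k$-element subsets of $\mathbb{Z}$ is $D(\mathcal{S})=\lim_{N\to\infty}\frac{|\mathcal{S}\cap\mathfrak{P}_k([N])|}{\binom{2N+1}{k}}$ if the limit exists; its multiplicative subset density is $D^{\times}(\mathcal{S})=\lim_{N\to\infty}\frac{|\mathcal{S}\cap\mathfrak{P}_k([N]^{\times})|}{\binom{2(N+1)^N}{k}}$ if the limit exists. ''Density zero'' means the limit exists and equals $0$. *)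

(* Defs.v *)
From HB Require Import structures.
From mathcomp Require Import all_boot all_order all_algebra.
From mathcomp Require Import finmap.
From mathcomp Require Import boolp classical_sets reals topology normedtype sequences exp.
From mathcomp Require Import Rstruct Rstruct_topology.
Set Implicit Arguments. Unset Strict Implicit. Unset Printing Implicit Defensive.
Import Order.TTheory GRing.Theory Num.Theory numFieldNormedType.Exports.
From mathcomp Require Import classical_sets.

Local Open Scope ring_scope.
Local Open Scope fset_scope.

Notation RR := Rdefinitions.R.

Definition qth_power_mod (q p : nat) (a : int) : Prop :=
  exists x : int, (a == x ^+ q %[mod p%:Z])%Z.

Definition contains_qth_power_mod (q : nat) (A : {fset int}) (p : nat) : Prop :=
  exists2 a, a \in A & qth_power_mod q p a.

Definition prime_count (P : nat -> Prop) (N : nat) : nat :=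
  #|[set p : 'I_N.+1 | prime p && `[< P p >]]|%N.

Definition rel_density (P : nat -> Prop) (d : RR) : Prop :=
  ((fun N : nat => (prime_count P N)%:R / (prime_count (fun _ => True) N)%:R : RR)
    @ \oo --> d)%classic.

Definition qth_power_ae (q : nat) (A : {fset int}) : Prop :=
  rel_density (contains_qth_power_mod q A) 1.

Definition S_qk (q k : nat) (A : {fset int}) : Prop :=
  #|` A| = k /\ qth_power_ae q A.

(* primes p_1 < p_2 < ...  (here 0-indexed: nth_prime 0 = 2) *)
Lemma ex_prime_above (m : nat) : exists p, (m < p)%N && prime p.
Proof. by case: (prime_above m) => p Hm Hp; exists p; rewrite Hm Hp. Qed.

Definition next_prime (m : nat) : nat := ex_minn (ex_prime_above m).

Fixpoint nth_prime (i : nat) : nat :=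
  match i with
  | 0 => 2
  | i'.+1 => next_prime (nth_prime i')
  end.

Definition add_box (N : nat) : {fset int} :=
  [fset (i%:Z - N%:Z) | i in iota 0 (2 * N).+1].

Definition mul_elt (N : nat) (x : bool * {ffun 'I_N -> 'I_N.+1}) : int :=
  (-1) ^+ x.1 * \prod_(i < N) (nth_prime i)%:Z ^+ (x.2 i).

Definition mul_box (N : nat) : {fset int} :=
  [fset mul_elt x | x in enum [set: bool * {ffun 'I_N -> 'I_N.+1}]].

Definition count_S (q k : nat) (X : {fset int}) : nat :=
  #|` [fset A in fpowerset X | `[< S_qk q k A >]]|.

Definition add_subset_density (q k : nat) (d : RR) : Prop :=
  ((fun N : nat => (count_S q k (add_box N))%:R / ('C((2 * N).+1, k))%:R : RR)
    @ \oo --> d)%classic.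

Definition mul_subset_density (q k : nat) (d : RR) : Prop :=
  ((fun N : nat => (count_S q k (mul_box N))%:R / ('C(2 * (N.+1 ^ N), k))%:R : RR)
    @ \oo --> d)%classic.

(* Main.v *)
(** For an irreducible monic [f] in Z[X], let [nb_roots f p] be the number of its
    roots modulo [p].  The sum of [nb_roots f p / p ^ s] over the primes [p <= x],
    with [s = 1 + 1 / ln x], is [ln (ln x) + O(1)]; this is [roots_mertens].
    Its proof is elementary.  A set [A] of "degree one primes" [(p, r)],
    [p %| f.[r]], has norm [prod p] and defines the lattice of the polynomials [c] of
    degree less than [deg f] with [p %| c.[r]] on [A]; the norm form (the resultant of
    [c] and [f]) is divisible by the norm of [A] on it.  By the pigeonhole principle
    each such lattice has a short vector, so there are [O(Y)] sets of norm at most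
    [Y].  Conversely a positive proportion of the [c] in a large box have a
    squarefree norm, hence come from some [A], and the divisibility makes the points
    of a lattice so far apart that each [A] occurs boundedly often; so there are
    at least [Y / K] sets.  Expanding the product of [1 + p ^ - s] over the degree
    one primes gives the asymptotics.

    Let [b_e = prod a_i ^ e_i].  If no [b_e] with [e] nonzero modulo [q] is a [q]th
    power, the asymptotics for ['X^q - b_e], for the [q]th cyclotomic polynomial and
    for ['X] give the weighted average of
    [G p = sum_e kappa e * (nb_roots ('X^q - b_e) p - 1)], where
    [kappa e = q * (sum e == 0) - 1].  It grows like [(q - 1) * ln (ln x)], but [G p]
    vanishes as soon as some [a_i] is a [q]th power modulo [p].  Hence the sets
    counted in the theorem are multiplicatively dependent modulo [q]th powers, and
    these are counted by fixing all the elements but one. *)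

Require Import Defs.
From HB Require Import structures.
From mathcomp Require Import all_boot all_order all_algebra all_field.
From mathcomp Require Import fingroup perm zify ring lra finmap.
From mathcomp Require Import boolp reals sequences exp.
Set Implicit Arguments. Unset Strict Implicit. Unset Printing Implicit Defensive.
Import Order.TTheory GRing.Theory Num.Theory.
Local Open Scope ring_scope.

(** * Integer matrices modulo a prime *)

Definition dvdmx (m : int) (a b : nat) (X : 'M[int]_(a, b)) := exists Y : (matrix int a b), X = m *: Y.

(** The upper bound writes the matrix as a sum of rank one pieces; the lower bound fills the zero
    entries with ones, which makes it invertible and raises the rank by at most their number. *)
Lemma rank_diag_mx (F : fieldType) m (r : 'rV[F]_m) :
  \rank (diag_mx r) = #|[set i | r 0 i != 0]|.
Proof.
have rkdelta (s : {set 'I_m}) (x : 'I_m -> F) :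
    (\rank (\sum_(i in s) x i *: delta_mx i i)%R <= #|s|)%N.
  rewrite -sum1_card; elim/big_rec2: _ => [|i A k _ le]; first by rewrite mxrank0.
  apply: leq_trans (mxrank_add _ _) _; apply: leq_add => //.
  by apply: leq_trans (mxrank_scale _ _) _; rewrite mxrank_delta.
have diagE : diag_mx r = \sum_(i in [set i | r 0 i != 0]) r 0 i *: delta_mx i i.
  rewrite diag_mx_sum_delta [RHS]big_mkcond /=; apply: eq_bigr => i _.
  by rewrite inE; case: eqVneq => //= ->; rewrite scale0r.
apply/eqP; rewrite eqn_leq {1}diagE rkdelta /=.
set Z := [set i | _].
have : (m <= \rank (diag_mx r + \sum_(i in ~: Z) 1 *: delta_mx i i)%R)%N.
  have -> : diag_mx r + \sum_(i in ~: Z) 1 *: delta_mx i i =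
            diag_mx (\row_i (if r 0 i == 0 then 1 else r 0 i)).
    rewrite !diag_mx_sum_delta [X in _ + X]big_mkcond /= -big_split /=.
    apply: eq_bigr => i _; rewrite !mxE !inE negbK; case: eqVneq => [->|_].
      by rewrite scale0r add0r.
    by rewrite addr0.
  rewrite mxrank_unit // unitmxE det_diag unitfE; apply/prodf_neq0 => i _.
  by rewrite mxE; case: ifPn => // _; rewrite oner_neq0.
move=> le1; rewrite -(leq_add2r #|~: Z|) cardsC card_ord.
apply: leq_trans (leq_trans le1 (mxrank_add _ _)) _; rewrite leq_add2l.
exact: rkdelta (fun=> 1).
Qed.

Lemma absz_det_unit m (A : 'M[int]_m) : A \in unitmx -> `|\det A|%N = 1%N.
Proof. by rewrite unitmxE -topredE /= /GRing.unit /= => /orP [] /eqP ->. Qed.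

Lemma map_intr_unitmx (F : fieldType) m (A : 'M[int]_m) :
  A \in unitmx -> map_mx (intr : int -> F) A \in unitmx.
Proof. by rewrite !unitmxE det_map_mx => /(rmorph_unit (intr : {rmorphism int -> F})). Qed.

Section Smith.
Variables (F : fieldType) (p : nat) (m : nat) (A : 'M[int]_m).
Hypothesis pF : p \in [pchar F].

(** The unimodular factors of the Smith form stay invertible modulo [p], so the diagonal alone
    carries both the determinant and the rank modulo [p]. *)
Lemma smith_diag : exists (L R : 'M[int]_m) (s : 'rV[int]_m),
  [/\ L \in unitmx, R \in unitmx, A = L *m diag_mx s *m R,
      `|\det A|%N = (\prod_i `|s 0%R i|)%N &
      \rank (map_mx (intr : int -> F) A) = #|[set i | ~~ (p %| s 0%R i)%Z]|].
Proof.
have [L uL [R uR [s _ AE]]] := int_Smith_normal_form A.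
exists L, R, (\row_i s`_i).
have E : A = L *m diag_mx (\row_i s`_i) *m R.
  rewrite AE; congr (_ *m _ *m _); apply/matrixP => i j; rewrite !mxE.
  by [].
split=> //.
  rewrite E !det_mulmx !abszM (absz_det_unit uL) (absz_det_unit uR) mul1n muln1 det_diag.
  by rewrite (big_morph _ abszM (erefl _)).
rewrite E !map_mxM map_diag_mx mxrankMfree ?row_free_unit ?map_intr_unitmx //.
rewrite -mxrank_tr trmx_mul mxrankMfree ?row_free_unit ?unitmx_tr ?map_intr_unitmx //.
rewrite mxrank_tr rank_diag_mx; apply: eq_card => i.
by rewrite !inE !mxE (dvdz_pcharf pF).
Qed.

(** Each diagonal entry of the Smith form that vanishes modulo [p] lowers the rank by one and puts a
    factor [p] into the determinant. *)
Lemma dvd_det_rank :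
  (p ^ (m - \rank (map_mx (intr : int -> F) A)) %| `|\det A|)%N.
Proof.
have [L [R [s [_ _ _ -> ->]]]] := smith_diag.
have -> : (m - #|[set i | ~~ (p %| s 0%R i)%Z]| = #|[set i | (p %| s 0%R i)%Z]|)%N.
  have := cardsC [set i | (p %| s 0%R i)%Z]; rewrite card_ord.
  have -> : ~: [set i | (p %| s 0%R i)%Z] = [set i | ~~ (p %| s 0%R i)%Z].
    by apply/setP => i; rewrite !inE.
  lia.
rewrite (bigID (mem [set i | (p %| s 0%R i)%Z])) /= dvdn_mulr //.
rewrite -prod_nat_const; elim/big_rec2: _ => // i a b; rewrite inE => Hi ab.
exact: dvdn_mul.
Qed.

(** With corank at most one, exactly one Smith entry is divisible by [p]; it absorbs all of [p ^ k]
    and the others are units. Hence the kernel modulo [p ^ k] is cyclic, generated by a column of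
    [invmx R]. *)
Lemma kernel_mod_prime_power k : (0 < k)%N -> (p ^ k %| `|\det A|)%N ->
  (m.-1 <= \rank (map_mx (intr : int -> F) A))%N ->
  exists u : 'cV[int]_m,
   [/\ exists i, ~~ (p %| u i 0%R)%Z, dvdmx (p ^ k)%N (A *m u) &
       forall u', dvdmx (p ^ k)%N (A *m u') -> exists t, dvdmx (p ^ k)%N (u' - t *: u)].
Proof.
have prp := pcharf_prime pF.
have [L [R [s [uL uR AE -> ->]]]] := smith_diag.
move=> k0 pk rk.
have [i0 Hi0] : exists i, (p %| s 0%R i)%Z.
  have : (p %| \prod_i `|s 0%R i|)%N by apply: dvdn_trans pk; rewrite dvdn_exp.
  by rewrite Euclid_dvd_prod // big_has => /hasP[i _ H]; exists i.
have Hi i : i != i0 -> ~~ (p %| s 0%R i)%Z.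
  move=> ne; apply/negP => Hi.
  have := cardsC [set i | ~~ (p %| s 0%R i)%Z]; rewrite card_ord.
  have : (1 < #|~: [set i | ~~ (p %| s 0%R i)%Z]|)%N.
    apply/card_gt1P; exists i, i0; rewrite !inE !negbK; split=> //.
  lia.
have cop i : i != i0 -> coprimez (p ^ k)%N (s 0 i).
  by move=> ne; rewrite /coprimez /gcdz /= eqz_nat -/(coprime _ _) coprimeXl // prime_coprime //; apply: Hi.
have pk0 : ((p ^ k)%N %| s 0%R i0)%Z.
  rewrite (bigD1 i0) //= mulnC Gauss_dvdr in pk => //.
  elim/big_rec: _ => [|i x ne cx]; first by rewrite coprimen1.
  by rewrite coprimeMr cx andbT; have := cop _ ne; rewrite /coprimez /gcdz /= eqz_nat.
exists (invmx R *m delta_mx i0 0); split.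
- case: (pickP (fun i => ~~ (p %| (invmx R *m delta_mx i0 (0%R : (ordinal 1))) i 0%R)%Z)) => [i Hi'|no].
    by exists i.
  (* If [p] divided the whole column, multiplying back by [R] would make it divide a unit vector. *)
  have : (p %| (delta_mx i0 0%R : (matrix int m 1)) i0 0%R)%Z.
    rewrite -[delta_mx _ _](mulKVmx uR) mxE; apply: rpred_sum => i _.
    by apply: dvdz_mull; have := no i; move/negbFE.
  by rewrite mxE !eqxx /= dvdzE /= dvdn1 => /eqP p1; rewrite p1 in prp.
- rewrite AE -!mulmxA mulKVmx //; have /dvdzP[x sx] := pk0.
  exists (L *m (x *: delta_mx i0 0)); rewrite scalemxAr; congr (L *m _).
  rewrite scalerA; apply/matrixP => i j; rewrite mul_diag_mx !mxE.
  by case: eqVneq => [->|_] /=; rewrite ?mulr0 // sx [_ * x]mulrC.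
- move=> u' [Y AY]; exists ((R *m u') i0 0).
  have HD : diag_mx s *m (R *m u') = (p ^ k)%N%:Z *: (invmx L *m Y).
    by rewrite scalemxAr -AY AE -!mulmxA mulKmx.
  have [W HW] : dvdmx (p ^ k)%N (R *m u' - (R *m u') i0 0 *: delta_mx i0 0).
    exists (\col_i ((R *m u' - (R *m u') i0 0%R *: delta_mx i0 0%R)%R i 0%R %/ (p ^ k)%N)%Z).
    apply/matrixP => i j; rewrite ord1 [RHS]mxE [X in _ * X]mxE mulrC divzK //.
    rewrite !mxE; case: (eqVneq i i0) => [->|ne].
      by rewrite eqxx mulr1 subrr.
    rewrite /= mulr0 subr0 -(Gauss_dvdzr _ (cop _ ne)).
    by move/matrixP/(_ i 0): HD; rewrite mul_diag_mx !mxE => ->; rewrite dvdz_mulr.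
  by exists (invmx R *m W); rewrite !scalemxAr -HW mulmxBr mulKmx.
Qed.

End Smith.

(** * The norm form of an irreducible polynomial *)

Lemma horner_mx_eigen (R : comNzRingType) n (A : 'M[R]_n.+1) (v : 'cV_n.+1) t g :
  A *m v = t *: v -> horner_mx A g *m v = g.[t] *: v.
Proof.
move=> Av; elim/poly_ind: g => [|g c IH]; first by rewrite rmorph0 mul0mx horner0 scale0r.
rewrite rmorphD rmorphM /= horner_mx_X horner_mx_C mulmxDl -mulmxA Av -scalemxAr IH.
by rewrite !hornerE mul_scalar_mx scalerA scalerDl mulrC.
Qed.

(** Row [i] expresses [X * X^i] in the basis [1, X, ..., X^n] of Z[X]/(f), so the powers of a root
    form a right eigenvector. *)
Definition companion n (f : {poly int}) : 'M[int]_n.+1 :=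
  \matrix_(i, j) if i == n :> nat then - f`_j else (i.+1 == j :> nat)%:R.

Definition elt_mx n (f : {poly int}) (c : 'rV[int]_n.+1) : 'M[int]_n.+1 :=
  horner_mx (companion n f) (rVpoly c).

(** The determinant of multiplication by [c] on Z[X]/(f): the norm form, of degree [n.+1] in the
    coefficients. *)
Definition normf n (f : {poly int}) (c : 'rV[int]_n.+1) : int := \det (elt_mx f c).

Lemma horner_congr (m : int) (g : {poly int}) (t t' : int) :
  (m %| t' - t)%Z -> (m %| g.[t'] - g.[t])%Z.
Proof.
move=> mt; elim/poly_ind: g => [|g a IH]; first by rewrite !horner0 subrr.
rewrite !hornerE.
have -> : g.[t'] * t' + a - (g.[t] * t + a) = (g.[t'] - g.[t]) * t' + g.[t] * (t' - t).
  by ring.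
by apply: rpredD; [apply: dvdz_mulr | apply: dvdz_mull].
Qed.

Lemma horner_taylor2 (g : {poly int}) (t t' : int) :
  exists h : int, g.[t'] = g.[t] + g^`().[t] * (t' - t) + h * (t' - t) ^+ 2.
Proof.
elim/poly_ind: g => [|g a [h IH]]; first by exists 0; rewrite deriv0 !horner0; ring.
exists (h * t' + g^`().[t]); rewrite derivD derivM derivX derivC !(hornerD, hornerM, hornerX, hornerC, mulr1, addr0) IH.
move: (g.[t]) (g^`().[t]) => A B; ring.
Qed.

Lemma intr_Zp_eq0 (m : nat) (x : int) : (1 < m)%N ->
  (x%:~R == 0 :> 'Z_m) = (m %| x)%Z.
Proof.
move=> m1.
have Hn k : (k%:R == 0 :> 'Z_m) = (m %| k)%N.
  by rewrite -val_eqE /= val_Zp_nat.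
by case: x => k; rewrite ?NegzE ?rmorphN ?oppr_eq0 -?pmulrn Hn dvdzE ?abszN.
Qed.

Lemma intr_pchar_eq (L : fieldType) p (x y : int) : p \in [pchar L] ->
  (x%:~R == y%:~R :> L) = (p %| x - y)%Z.
Proof. by move=> pL; rewrite (dvdz_pcharf pL) rmorphB subr_eq0. Qed.

Section Companion.
Variables (n : nat) (f : {poly int}).
Hypotheses (f_monic : f \is monic) (size_f : size f = n.+2).
Local Notation M := (companion n f).
Local Notation N := (normf f).

Lemma lead_f : f`_n.+1 = 1.
Proof. by move/monicP: f_monic; rewrite /lead_coef size_f. Qed.

Lemma coef_map_intr (R : nzRingType) (g : {poly int}) i :
  (map_poly (intr : int -> R) g)`_i = (g`_i)%:~R.
Proof. by rewrite coef_map_id0. Qed.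

Lemma horner_map_intr (R : comNzRingType) (g : {poly int}) (t : int) :
  (map_poly (intr : int -> R) g).[t%:~R] = (g.[t])%:~R.
Proof. exact: (horner_map (intr : {rmorphism int -> R})). Qed.

Lemma companion_eigen (R : comNzRingType) (t : R) :
  root (map_poly intr f) t ->
  map_mx intr M *m (\col_i t ^+ i) = t *: (\col_i t ^+ i).
Proof.
move=> /rootP ft; apply/colP => i; rewrite !mxE -exprS.
case: (eqVneq (i : nat) n) => [ein|nin].
  under eq_bigr do rewrite !mxE ein eqxx.
  have S : \sum_(j < n.+1) (f`_j)%:~R * t ^+ j + t ^+ n.+1 = 0.
    rewrite -[RHS]ft (@horner_coef_wide _ n.+2); last by rewrite (leq_trans (size_poly _ _)) ?size_f.
    rewrite [RHS]big_ord_recr /= coef_map_intr lead_f mul1r; congr (_ + _).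
    by apply: eq_bigr => j _; rewrite coef_map_intr.
  under eq_bigr do rewrite rmorphN /= mulNr.
  by move/eqP: S; rewrite addrC addr_eq0 ein sumrN => /eqP ->.
have lt : (i.+1 < n.+1)%N by move: (ltn_ord i) nin; lia.
rewrite (bigD1 (Ordinal lt)) //= big1 ?addr0.
  by rewrite !mxE (negPf nin) eqxx mul1r.
move=> j; rewrite -val_eqE /= => nj; rewrite !mxE (negPf nin) eq_sym (negPf nj).
by rewrite mul0r.
Qed.

Lemma elt_mx_eigen (R : comNzRingType) (t : R) (c : 'rV[int]_n.+1) :
  root (map_poly intr f) t ->
  map_mx intr (elt_mx f c) *m (\col_i t ^+ i) =
    (map_poly intr (rVpoly c)).[t] *: (\col_i t ^+ i).
Proof.
move=> ft; rewrite /elt_mx map_horner_mx.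
exact/horner_mx_eigen/companion_eigen.
Qed.

(** The vector of powers of [t] is killed by the matrix of [c] and has first entry 1. The adjugate
    turns this into a vanishing determinant even when [R] has zero divisors, as for residues modulo
    [p ^ 2]. *)
Lemma normf_root (R : comNzRingType) (t : R) (c : 'rV[int]_n.+1) :
  root (map_poly intr f) t -> root (map_poly intr (rVpoly c)) t ->
  (N c)%:~R = 0 :> R.
Proof.
move=> ft /rootP ct; have := elt_mx_eigen c ft; rewrite ct scale0r.
move/(congr1 (mulmx (\adj (map_mx intr (elt_mx f c))))).
rewrite mulmxA mul_adj_mx mulmx0 mul_scalar_mx => /colP /(_ 0).
by rewrite !mxE expr0 mulr1 det_map_mx.
Qed.

Lemma delta_companion_exp k : (k <= n)%N ->
  delta_mx 0 0 *m M ^+ k = delta_mx 0 (inord k) :> 'rV_n.+1.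
Proof.
elim: k => [|k IH] kn; first by rewrite expr0 mulmx1; congr delta_mx; apply/val_inj; rewrite /= inordK.
rewrite exprSr -[M ^+ k * M]/(M ^+ k *m M) mulmxA IH ?(ltnW kn) //.
rewrite -rowE; apply/rowP => j; rewrite !mxE inordK ?(ltnW kn) ?ltnS ?(ltnW kn) //.
by rewrite ltn_eqF //= -val_eqE /= inordK ?ltnS // eq_sym.
Qed.

(** The first basis row is a cyclic vector: its images under the powers of [M] are all the basis
    rows. It is killed by [f] evaluated at [M], and this commutes with [M], so every row
    vanishes. *)
Lemma horner_companion : horner_mx M f = 0.
Proof.
have e0 : delta_mx 0 0 *m horner_mx M f = 0 :> 'rV_n.+1.
  rewrite -[X in horner_mx _ X]coefK poly_def size_f raddf_sum /= mulmx_sumr big_ord_recr /=.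
  under eq_bigr => k _.
    rewrite linearZ /= rmorphXn /= horner_mx_X -scalemxAr delta_companion_exp -1?ltnS //; over.
  rewrite linearZ /= rmorphXn /= horner_mx_X -scalemxAr lead_f scale1r.
  rewrite exprSr -[M ^+ n * M]/(M ^+ n *m M) mulmxA delta_companion_exp // -rowE.
  apply/rowP => j; rewrite mxE summxE (bigD1 j) //= big1.
    by rewrite !mxE inordK // inord_val !eqxx mulr1 addr0 subrr.
  move=> k nk; rewrite !mxE inord_val eq_sym (negPf nk) mulr0 //.
apply/row_matrixP => i; rewrite row0 rowE.
have -> : delta_mx 0 i = delta_mx 0 0 *m M ^+ i :> 'rV_n.+1.
  by rewrite delta_companion_exp ?inord_val // -ltnS.
rewrite -mulmxA.
have -> : M ^+ i *m horner_mx M f = horner_mx M f *m M ^+ i.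
  have -> : M ^+ i = horner_mx M 'X^i by rewrite rmorphXn /= horner_mx_X.
  exact: comm_horner_mx2.
by rewrite mulmxA e0 mul0mx.
Qed.

(** The kernel of the matrix of [c] modulo [p ^ k] is cyclic and stable under the companion matrix,
    which therefore acts on the generator by a scalar. That scalar is the common root. *)
Lemma root_of_norm_prime_power (F : fieldType) p k (c : 'rV[int]_n.+1) : p \in [pchar F] ->
  (0 < k)%N -> (p ^ k %| `|N c|)%N ->
  (n <= \rank (map_mx (intr : int -> F) (elt_mx f c)))%N ->
  exists t : int, ((p ^ k)%N %| f.[t])%Z && ((p ^ k)%N %| (rVpoly c).[t])%Z.
Proof.
move=> pF k0 pk rk; have prp := pcharf_prime pF.
have [u [[i ui] Au uniq_u]] := kernel_mod_prime_power pF k0 pk rk.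
have comM g : horner_mx M g *m M = M *m horner_mx M g.
  by have := comm_horner_mx2 M g 'X; rewrite horner_mx_X.
have [t [Y MY]] : exists t, dvdmx (p ^ k)%N (M *m u - t *: u).
  apply: uniq_u; case: Au => Y AY; exists (M *m Y).
  by rewrite mulmxA /elt_mx comM -mulmxA AY scalemxAr.
have gt g : dvdmx (p ^ k)%N (horner_mx M g *m u - g.[t] *: u).
  elim/poly_ind: g => [|g a [Z IH]].
    by exists 0; rewrite rmorph0 mul0mx horner0 scale0r subrr scaler0.
  exists (horner_mx M g *m Y + t *: Z).
  rewrite scalerDr scalemxAr -MY scalerA [_ * t]mulrC -scalerA -IH.
  rewrite rmorphD rmorphM /= horner_mx_X horner_mx_C mulmxDl mul_scalar_mx !hornerE.
  rewrite mulmxBr mulmxA -scalemxAr scalerBr scalerA scalerDl [t * _]mulrC.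
  by rewrite subrKA opprD addrACA subrr addr0.
(* The coordinate [u i 0] is prime to [p], so it can be cancelled. *)
have dvd g : dvdmx (p ^ k)%N (horner_mx M g *m u) -> ((p ^ k)%N %| g.[t])%Z.
  case=> Z HZ; have [W'] := gt g; rewrite HZ => /colP /(_ i); rewrite !mxE => E.
  have : ((p ^ k)%N %| (g.[t] * u i 0)%R)%Z.
    have -> : g.[t] * u i 0%R = (p ^ k)%N%:Z * (Z i 0 - W' i 0).
      by rewrite mulrBr -E opprB addrC subrK.
    by rewrite dvdz_mulr.
  rewrite mulrC Gauss_dvdzr // /coprimez /gcdz /= eqz_nat -/(coprime _ _) coprimeXl //.
  by rewrite prime_coprime.
exists t; rewrite !dvd //; exists 0; by rewrite horner_companion mul0mx scaler0.
Qed.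

Section Irreducible.
Hypothesis f_irr : irreducible_poly (map_poly (intr : int -> rat) f).

(** A nonzero [c] of smaller degree is coprime to the irreducible [f] over the rationals; evaluating
    a Bezout relation at the companion matrix inverts the matrix of [c]. *)
Lemma normf_neq0 (c : 'rV[int]_n.+1) : c != 0 -> N c != 0.
Proof.
move=> c0; set g := map_poly (intr : int -> rat) (rVpoly c).
have g0 : g != 0.
  rewrite map_poly_eq0_id0 ?intr_eq0 ?lead_coef_eq0.
    by apply: contraNneq c0 => c0; rewrite -(rVpolyK c) c0 linear0.
  by apply: contraNneq c0 => c0; rewrite -(rVpolyK c) c0 linear0.
have : coprimep (map_poly intr f) g.
  rewrite irreducible_poly_coprime //; apply/negP => /(dvdp_leq g0).
  rewrite size_map_poly_id0; last by rewrite (monicP f_monic) oner_neq0.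
  by rewrite size_f leqNgt !ltnS (leq_trans (size_poly _ _)) // size_poly.
case/Bezout_eq1_coprimepP=> [[u v] /= E].
move/(congr1 (horner_mx (map_mx intr M))): E.
rewrite rmorphD !rmorphM rmorph1 /= -!map_horner_mx horner_companion map_mx0 mulr0 add0r.
move/(congr1 determinant); rewrite det1 detM => E.
apply: contra_eq_neq E => E.
by rewrite det_map_mx [\det (horner_mx M _)]E mulr0 eq_sym oner_neq0.
Qed.

(** The integer [D] plays the part of the discriminant: modulo a prime not dividing it, the relation
    makes [f] separable. *)
Lemma bezout_deriv : exists (D : int) (u v : {poly int}),
  D != 0 /\ u * f + v * f^`() = D%:P.
Proof.
have lf0 : (lead_coef f)%:~R != 0 :> rat by rewrite (monicP f_monic) oner_neq0.
have szf : size (map_poly (intr : int -> rat) f) = n.+2 by rewrite size_map_poly_id0.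
have : coprimep (map_poly (intr : int -> rat) f) (map_poly intr f^`()).
  rewrite irreducible_poly_coprime //; apply/negP => /dvdp_leq.
  rewrite szf => H; have : (n.+2 <= n.+1)%N; last by rewrite ltnn.
  apply: leq_trans (H _) _.
    apply/eqP => /polyP /(_ n); rewrite coef_map_intr coef_deriv coef0 lead_f.
    by move/eqP; rewrite intr_eq0 pnatr_eq0.
  by rewrite (leq_trans (size_poly _ _)) // (leq_trans (size_poly _ _)) ?size_f.
case/Bezout_eq1_coprimepP=> [[u v] /= E].
have [u' [a a0 uE]] := rat_poly_scale u; have [v' [b b0 vE]] := rat_poly_scale v.
exists (a * b), (b *: u'), (a *: v'); split; first by rewrite mulf_neq0.
apply: (@map_inj_poly _ _ (intr : int -> rat)) => //; first exact: intr_inj.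
rewrite map_polyC /= rmorphD !rmorphM /= !map_polyZ /=.
have -> : map_poly intr u' = a%:~R *: u by rewrite uE scalerA mulfV ?intr_eq0 // scale1r.
have -> : map_poly intr v' = b%:~R *: v by rewrite vE scalerA mulfV ?intr_eq0 // scale1r.
rewrite !scalerA -!scalerAl [_ * a%:~R]mulrC -scalerDr E alg_polyC.
by rewrite rmorphM.
Qed.
End Irreducible.


Lemma root_factored (L : fieldType) (z : 'I_n.+1 -> L) (x : L) :
  map_poly intr f = \prod_i ('X - (z i)%:P) ->
  root (map_poly intr f) x = [exists i, x == z i].
Proof.
move=> ->; rewrite rootE horner_prod; apply/prodf_eq0/existsP => [[i _]|[i xi]].
  by rewrite !hornerE subr_eq0 => xi; exists i.
by exists i; rewrite // !hornerE /= (eqP xi) subrr.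
Qed.

(** When [f] splits with distinct roots, the Vandermonde matrix diagonalises multiplication by [c];
    the corank is thus the number of common roots. *)
Lemma rank_elt_mx (L : fieldType) (z : 'I_n.+1 -> L) (c : 'rV[int]_n.+1) :
  injective z -> map_poly intr f = \prod_i ('X - (z i)%:P) ->
  \rank (map_mx (intr : int -> L) (elt_mx f c)) =
    #|[set j | (map_poly intr (rVpoly c)).[z j] != 0]|.
Proof.
move=> zI fE; pose V := Vandermonde n.+1 (\row_j z j).
have uV : V \in unitmx.
  rewrite unitmxE det_Vandermonde unitfE; apply/prodf_neq0 => i _.
  apply/prodf_neq0 => j ij; rewrite !mxE subr_eq0 (inj_eq zI).
  by apply: contraTneq ij => ->; rewrite ltnn.
have rz j : root (map_poly intr f) (z j).
  by rewrite (root_factored _ fE); apply/existsP; exists j.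
have E : map_mx intr (elt_mx f c) *m V =
    V *m diag_mx (\row_j (map_poly intr (rVpoly c)).[z j]).
  apply/matrixP => i j.
  transitivity ((map_mx intr (elt_mx f c) *m (\col_i z j ^+ i)) i 0).
    by rewrite !mxE; apply: eq_bigr => k _; rewrite !mxE.
  by rewrite elt_mx_eigen // mul_mx_diag !mxE mulrC.
rewrite -(mxrankMfree _ (_ : row_free V)) ?row_free_unit // E.
rewrite -mxrank_tr trmx_mul mxrankMfree ?row_free_unit ?unitmx_tr //.
rewrite mxrank_tr rank_diag_mx; apply: eq_card => j; by rewrite !inE !mxE.
Qed.

Section LocalPrime.
Variables (D : int) (u v : {poly int}) (p : nat).
Hypotheses (uvD : u * f + v * f^`() = D%:P) (prp : prime p) (pD : ~~ (p %| D)%Z).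

Lemma splitting_mod_p : exists (L : fieldType) (z : 'I_n.+1 -> L),
  [/\ p \in [pchar L], injective z &
      map_poly (intr : int -> L) f = \prod_i ('X - (z i)%:P)].
Proof.
have [L [h _]] := countable_algebraic_closure 'F_p.
have pL : p \in [pchar L] by apply: (rmorph_pchar h); apply: pchar_Fp.
have [r rE] := closed_field_poly_normal (map_poly (intr : int -> L) f).
have fmon : map_poly (intr : int -> L) f \is monic by rewrite monic_map.
rewrite (monicP fmon) scale1r in rE.
have sr : size r = n.+1.
  apply/eqP; rewrite -eqSS -size_f -(size_map_poly_id0 (f := intr : int -> L)).
    by rewrite rE size_prod_XsubC.
  by rewrite (monicP f_monic) oner_neq0.
have ur : uniq r.
  rewrite -separable_prod_XsubC -rE unlock.
  apply/Bezout_coprimepP; exists (map_poly intr u, map_poly intr v) => /=.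
  rewrite deriv_map -!rmorphM -rmorphD /= uvD map_polyC /= -alg_polyC.
  by rewrite eqp_scale // -(dvdz_pcharf pL).
exists L, (fun i => r`_i); split => //.
  by move=> i j /eqP; rewrite nth_uniq ?sr // => /eqP /val_inj.
by rewrite rE (big_nth 0) big_mkord sr.
Qed.

Lemma dvd_normf_roots (c : 'rV[int]_n.+1) (s : seq nat) :
  uniq s -> {in s, forall r, [&& (r < p)%N, (p %| f.[r%:Z])%Z & (p %| (rVpoly c).[r%:Z])%Z]} ->
  (p ^ size s %| `|N c|)%N.
Proof.
move=> us Hs; have [L [z [pL zI fE]]] := splitting_mod_p.
apply: dvdn_trans (dvd_det_rank (elt_mx f c) pL); rewrite dvdn_exp2l //.
rewrite (rank_elt_mx c zI fE).
set S := [set j | _].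
have cS : (n.+1 - #|S| = #|~: S|)%N by have := cardsC S; rewrite card_ord; lia.
rewrite cS cardE.
have us' : uniq [seq (r%:Z)%:~R : L | r <- s].
  rewrite map_inj_in_uniq // => x y /Hs /and3P [xp _ _] /Hs /and3P [yp _ _] /eqP.
  rewrite (intr_pchar_eq _ _ pL) -eqz_mod_dvd !modz_nat eqz_nat !modn_small //.
  by move/eqP.
rewrite -(size_map (fun r : nat => (r%:Z)%:~R : L)) -(size_map z).
apply: uniq_leq_size => // _ /mapP [r /Hs /and3P [_ fr cr] ->].
have : root (map_poly intr f) ((r%:Z)%:~R : L).
  by rewrite rootE horner_map_intr -(dvdz_pcharf pL).
rewrite (root_factored _ fE) => /existsP [i /eqP ri].
apply/mapP; exists i => //; rewrite mem_enum !inE negbK -ri horner_map_intr.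
by rewrite -(dvdz_pcharf pL).
Qed.

Lemma square_root_unique (t t' : int) :
  ((p ^ 2)%N %| f.[t])%Z -> ((p ^ 2)%N %| f.[t'])%Z -> (p %| t' - t)%Z ->
  ((p ^ 2)%N %| t' - t)%Z.
Proof.
move=> ft ft' pe; have [h E] := horner_taylor2 f t t'.
have pe2 : ((p ^ 2)%N %| ((t' - t) ^+ 2)%R)%Z.
  by have := dvdz_exp2r 2 pe; rewrite -rmorphXn natrXE.
have H : ((p ^ 2)%N %| (f^`().[t] * (t' - t))%R)%Z.
  have -> : f^`().[t] * (t' - t) = f.[t'] - f.[t] - h * (t' - t) ^+ 2 by rewrite E; ring.
  by rewrite !rpredB // dvdz_mull.
rewrite Gauss_dvdzr // in H.
rewrite /coprimez /gcdz /= eqz_nat -/(coprime _ _) coprimeXl // prime_coprime //.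
apply: contra pD => pf'.
have /(congr1 (fun g => g.[t])) := uvD; rewrite !hornerE => <-.
rewrite rpredD // dvdz_mull //; apply: dvdz_trans ft.
by rewrite dvdzE /= dvdn_exp.
Qed.

(** The vectors with norm divisible by [p ^ 2] need not be closed under differences, but they are
    covered by boundedly many families that are. Such divisibility comes either from two distinct
    common roots modulo [p], or from one common root modulo [p ^ 2]. *)
Lemma square_lattices :
  exists Lam : 'I_n.+1 * 'I_n.+1 -> 'rV[int]_n.+1 -> Prop,
  [/\ forall k c c', Lam k c -> Lam k c' -> Lam k (c - c'),
      forall k (P : int) c, ~~ (p %| P)%Z -> Lam k (P *: c) -> Lam k c,
      forall k c, Lam k c -> (p ^ 2 %| `|N c|)%N &
      forall c, (p ^ 2 %| `|N c|)%N -> exists k, Lam k c].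
Proof.
have [L [z [pL zI fE]]] := splitting_mod_p.
pose ev (c : 'rV[int]_n.+1) i := (map_poly (intr : int -> L) (rVpoly c)).[z i].
(* A diagonal index asks for a common root modulo [p ^ 2] above [z k.1]; the other indices ask that
   two distinct roots of [f] be roots of [c]. *)
exists (fun k c => if k.1 == k.2
  then exists t : int, [/\ t%:~R = z k.1, ((p ^ 2)%N %| f.[t])%Z & ((p ^ 2)%N %| (rVpoly c).[t])%Z]
  else ev c k.1 = 0 /\ ev c k.2 = 0); split.
- move=> [i j] c c' /=; case: eqP => [_ [t [tz ft ct]] [t' [tz' ft' ct']]|_ [ci cj] [ci' cj']].
    exists t; split => //; rewrite raddfB /= !hornerE rpredB //.
    (* The two vectors may come with different lifts of the same root; these lifts agree modulo
       [p ^ 2]. *)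
    have pt : (p %| t' - t)%Z by rewrite -(intr_pchar_eq _ _ pL) tz tz'.
    have := horner_congr (rVpoly c') (square_root_unique ft ft' pt).
    by rewrite rpredBl.
  by split; rewrite /ev raddfB /= rmorphB /= !hornerE [X in X - _](ci, cj) [X in _ - X](ci', cj') subrr.
- move=> [i j] P c pP /=; case: eqP => [_ [t [tz ft ct]]|_ [ci cj]].
    exists t; split => //; move: ct; rewrite linearZ /= hornerZ Gauss_dvdzr //.
    by rewrite /coprimez /gcdz /= eqz_nat -/(coprime _ _) coprimeXl // prime_coprime.
  have P0 : P%:~R != 0 :> L by rewrite -(dvdz_pcharf pL).
  move: ci cj; rewrite /ev linearZ /= map_polyZ /= !hornerZ => /eqP + /eqP.
  by rewrite !mulf_eq0 (negPf P0) /= => /eqP + /eqP.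
- move=> [i j] c /=; case: eqP => [_ [t [tz ft ct]]|/eqP ne [ci cj]].
    have p2 : (1 < p ^ 2)%N by rewrite -(exp1n 2) ltn_exp2r // prime_gt1.
    have : ((N c)%:~R == 0 :> 'Z_(p ^ 2)); last by rewrite intr_Zp_eq0.
    apply/eqP/(@normf_root _ (t%:~R)).
      by rewrite rootE horner_map_intr intr_Zp_eq0.
    by rewrite rootE horner_map_intr intr_Zp_eq0.
  apply: dvdn_trans (dvd_det_rank (elt_mx f c) pL); rewrite dvdn_exp2l //.
  rewrite (rank_elt_mx c zI fE); set S := [set j | _].
  have -> : (n.+1 - #|S| = #|~: S|)%N by have := cardsC S; rewrite card_ord; lia.
  by apply/card_gt1P; exists i, j; rewrite !inE !negbK; split => //; apply/eqP.
- move=> c pc.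
  have [rk|rk] := leqP n (\rank (map_mx (intr : int -> L) (elt_mx f c))).
    have [t /andP [ft ct]] := root_of_norm_prime_power pL (isT : (0 < 2)%N) pc rk.
    have : root (map_poly intr f) (t%:~R : L).
      rewrite rootE horner_map_intr -(dvdz_pcharf pL); apply: dvdz_trans ft.
      by rewrite dvdzE /= dvdn_exp.
    rewrite (root_factored _ fE) => /existsP [i /eqP ri].
    by exists (i, i); rewrite /= eqxx; exists t.
  move: rk; rewrite (rank_elt_mx c zI fE); set S := [set j | _] => rk.
  have : (1 < #|~: S|)%N by have := cardsC S; rewrite card_ord; lia.
  case/card_gt1P => i [j []]; rewrite !inE !negbK => /eqP ci /eqP cj /negPf ij.
  by exists (i, j); rewrite /= ij.
Qed.

Lemma root_of_norm_prime (c : 'rV[int]_n.+1) :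
  (p %| `|N c|)%N -> ~~ (p ^ 2 %| `|N c|)%N ->
  exists r : nat, [&& (r < p)%N, (p %| f.[r%:Z])%Z & (p %| (rVpoly c).[r%:Z])%Z].
Proof.
have [L [z [pL zI fE]]] := splitting_mod_p => pc pc2.
(* A corank of two or more would force [p ^ 2] into the norm. *)
have rk : (n <= \rank (map_mx (intr : int -> L) (elt_mx f c)))%N.
  rewrite leqNgt; apply: contra pc2 => rk.
  apply: dvdn_trans (dvd_det_rank (elt_mx f c) pL); rewrite dvdn_exp2l //; lia.
have [t] := root_of_norm_prime_power pL (isT : (0 < 1)%N) pc rk.
rewrite expn1 => /andP [ft ct].
have p0 : p%:Z != 0 by case: p prp.
have E : ((`|(t %% p)%Z|%N)%:Z = t %% p)%Z by rewrite gez0_abs // modz_ge0.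
exists `|(t %% p)%Z|%N; rewrite E; apply/and3P.
have pt : (p %| (t - (t %% p)%Z)%R)%Z by rewrite {1}(divz_eq t p) addrK dvdz_mull.
split.
- by rewrite -ltz_nat E ltz_pmod // ltz_nat prime_gt0.
- by have := horner_congr f pt; rewrite rpredBl.
- by have := horner_congr (rVpoly c) pt; rewrite rpredBl.
Qed.

End LocalPrime.

End Companion.

(** * Size of determinants and of the norm form *)

Lemma det_bound d (A : 'M[int]_d) (B : nat) :
  (forall i j, `|A i j| <= B%:Z) -> `|\det A| <= (d`! * B ^ d)%N%:Z.
Proof.
move=> AB; apply: le_trans (ler_norm_sum _ _ _) _.
have : forall s : 'S_d, true -> `|(-1) ^+ s * \prod_i A i (s i)| <= (B ^ d)%N%:Z.
  move=> s _; rewrite normrM normrX normrN1 expr1n mul1r normr_prod.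
  have -> : (B ^ d)%N%:Z = \prod_(i < d) B%:Z :> int.
    by rewrite prodr_const card_ord -natrXE rmorphXn.
  by apply: ler_prod => i _; rewrite normr_ge0 AB.
move/ler_sum/le_trans; apply.
rewrite sumr_const card_Sn PoszM -mulr_natl; lia.
Qed.

(** In the Leibniz formula the identity contributes at least [(t - b) ^ n.+1]. Any other permutation
    meets an off-diagonal entry, of size at most [b], and its remaining factors are at most [t + b],
    hence at most twice [t - b]. *)
Lemma det_diag_dominant n (B : 'M[int]_n.+1) (t b : nat) :
  (forall i j, `|B i j| <= b%:Z) -> ((2 + n.+1`! * 2 ^ n) * b <= t)%N ->
  (b ^ n.+1)%N%:Z <= \det (t%:Z%:M + B).
Proof.
move=> Bb Ht; set A := _ + B; set H := (n.+1`! * 2 ^ n)%N in Ht.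
have b0 : 0 <= b%:Z by [].
have Aij i j : i != j -> `|A i j| <= b%:Z.
  by move=> /negPf ij; rewrite !mxE ij mulr0n add0r Bb.
have Aii i : t%:Z - b%:Z <= A i i /\ `|A i i| <= t%:Z + b%:Z.
  rewrite !mxE eqxx mulr1n; move: (Bb i i); move: (B i i) => x; rewrite !ler_norml => /andP[h1 h2].
  by split; [|apply/andP; split]; lia.
have Hb : (n.+1`! * 2 ^ n * b + 2 * b <= t)%N by rewrite -mulnDl addnC.
have F1 : (0 < n.+1`! * 2 ^ n)%N by rewrite muln_gt0 fact_gt0 expn_gt0.
have tb2 : t%:Z + b%:Z <= 2 * (t%:Z - b%:Z).
  have : (b <= n.+1`! * 2 ^ n * b)%N by rewrite leq_pmull.
  lia.
have tb0 : 0 <= t%:Z - b%:Z by lia.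
rewrite /determinant (bigD1 1%g) //= odd_perm1 expr0 mul1r.
have off (s : 'S_n.+1) : s != 1%g ->
    `|(-1) ^+ s * \prod_i A i (s i)| <= b%:Z * (t%:Z + b%:Z) ^+ n.
  move=> s1; have [i si] : exists i, s i != i.
    apply/existsP; apply: contraR s1; rewrite negb_exists => /forallP h.
    by apply/eqP/permP => i; rewrite perm1; apply/eqP; have := h i; rewrite negbK.
  rewrite normrM normrX normrN1 expr1n mul1r normr_prod (bigD1 i) //=.
  apply: ler_pM => //; first by rewrite prodr_ge0.
    by apply: Aij; rewrite eq_sym.
  have -> : (t%:Z + b%:Z) ^+ n = \prod_(j < n.+1 | j != i) (t%:Z + b%:Z).
    by rewrite prodr_const cardC1 card_ord.
  apply: ler_prod => j _; rewrite normr_ge0 /=.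
  case: (eqVneq j (s j)) => [<-|ne]; first by have [] := Aii j.
  by apply: le_trans (Aij _ _ ne) _; lia.
have main : (t%:Z - b%:Z) ^+ n.+1 <= \prod_i A i ((1%g : 'S_n.+1) i).
  have -> : (t%:Z - b%:Z) ^+ n.+1 = \prod_(j < n.+1) (t%:Z - b%:Z).
    by rewrite prodr_const card_ord.
  by apply: ler_prod => j _; rewrite perm1 tb0; have [] := Aii j.
have rest : `|\sum_(s : 'S_n.+1 | s != 1%g) (-1) ^+ s * \prod_i A i (s i)| <=
    n.+1`!%:Z * (b%:Z * (t%:Z + b%:Z) ^+ n).
  apply: le_trans (ler_norm_sum _ _ _) _.
  apply: (@le_trans _ _ (\sum_(s : 'S_n.+1 | s != 1%g) b%:Z * (t%:Z + b%:Z) ^+ n)).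
    by apply: ler_sum => s; apply: off.
  rewrite sumr_const -[X in X <= _]mulr_natl ler_wpM2r //.
    by rewrite mulr_ge0 // exprn_ge0 //; lia.
  by rewrite natz lez_nat -card_Sn max_card.
have pw : (t%:Z + b%:Z) ^+ n <= 2 ^+ n * (t%:Z - b%:Z) ^+ n.
  by rewrite -exprMn lerXn2r ?nnegrE //; lia.
have fin : n.+1`!%:Z * (b%:Z * (t%:Z + b%:Z) ^+ n) + b%:Z ^+ n.+1 <= (t%:Z - b%:Z) ^+ n.+1.
  rewrite exprS [X in _ <= X]exprS.
  have p1 : b%:Z ^+ n <= (t%:Z - b%:Z) ^+ n by rewrite lerXn2r ?nnegrE //; lia.
  have h1 : n.+1`!%:Z * (b%:Z * (t%:Z + b%:Z) ^+ n) <=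
            n.+1`!%:Z * (b%:Z * (2 ^+ n * (t%:Z - b%:Z) ^+ n)).
    by rewrite !ler_wpM2l.
  have h2 : b%:Z * b%:Z ^+ n <= b%:Z * (t%:Z - b%:Z) ^+ n by rewrite ler_wpM2l.
  have h3 : (n.+1`!%:Z * 2 ^+ n * b%:Z + b%:Z) * (t%:Z - b%:Z) ^+ n <=
     (t%:Z - b%:Z) * (t%:Z - b%:Z) ^+ n.
    apply: ler_wpM2r; first by rewrite exprn_ge0.
    have -> : n.+1`!%:Z * 2 ^+ n = (n.+1`! * 2 ^ n)%N%:Z by rewrite PoszM -natrXE rmorphXn.
    lia.
  apply: le_trans h3; apply: le_trans (lerD h1 h2) _.
  by rewrite le_eqVlt; apply/orP; left; apply/eqP; ring.
have -> : (b ^ n.+1)%N%:Z = b%:Z ^+ n.+1 by rewrite -natrXE rmorphXn.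
move: rest; rewrite ler_norml => /andP[r1 _]; apply: le_trans (lerD main r1).
by rewrite lerBrDr addrC.
Qed.

Section Bounds.
Variables (n : nat) (f : {poly int}).
Local Notation N := (normf f).
Local Notation d := n.+1.

Lemma elt_mx_sum (c : 'rV[int]_n.+1) :
  elt_mx f c = \sum_k c 0 k *: companion n f ^+ k.
Proof.
rewrite /elt_mx {1}(row_sum_delta c) linear_sum raddf_sum /=.
apply: eq_bigr => k _; rewrite linearZ /= linearZ /= rVpoly_delta rmorphXn /=.
by rewrite horner_mx_X.
Qed.

Lemma elt_mx_bound : exists E : nat, (0 < E)%N /\
  forall (c : 'rV[int]_n.+1) (Z : nat), (forall i, `|c 0 i| <= Z%:Z) ->
  forall i j, `|elt_mx f c i j| <= (E * Z)%N%:Z.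
Proof.
pose E := (1 + \sum_(k < n.+1) \sum_(i < n.+1) \sum_(j < n.+1) `|(companion n f ^+ k) i j|)%N.
exists E; split=> // c Z cZ i j; rewrite elt_mx_sum summxE.
apply: le_trans (ler_norm_sum _ _ _) _.
have h k : true -> `|(c 0 k *: companion n f ^+ k) i j| <=
    Z%:Z * `|(companion n f ^+ k) i j|.
  by move=> _; rewrite mxE normrM ler_wpM2r.
apply: (@le_trans _ _ (\sum_(k < n.+1) Z%:Z * `|(companion n f ^+ k) i j|)).
  by apply: ler_sum => k; apply: h.
rewrite -mulr_sumr PoszM mulrC ler_wpM2r //.
have -> : \sum_(k < n.+1) `|(companion n f ^+ k) i j| =
    (\sum_(k < n.+1) `|(companion n f ^+ k) i j|%N)%N%:Z.
  by rewrite -[RHS]natz natr_sum; apply: eq_bigr => k _; rewrite natz abszE.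
rewrite lez_nat /E; apply: leq_trans (leq_addl _ _); apply: leq_sum => k _.
rewrite (bigD1 i) //= (bigD1 j) //= -addnA; exact: leq_addr.
Qed.

Lemma normf_bound : exists C : nat, (0 < C)%N /\
  forall (c : 'rV[int]_n.+1) (Z : nat), (forall i, `|c 0 i| <= Z%:Z) ->
  (`|N c| <= C * Z ^ n.+1)%N.
Proof.
have [E [E0 HE]] := elt_mx_bound.
exists (n.+1`! * E ^ n.+1)%N; split; first by rewrite muln_gt0 fact_gt0 expn_gt0 E0.
move=> c Z cZ; have := det_bound (HE _ _ cZ).
by rewrite -abszE lez_nat expnMn mulnA.
Qed.
End Bounds.

(** * Counting sets of degree one primes *)

(** A pair [(p, r)] encodes the ideal (p, X - r) of Z[X]/(f), of norm [p]; primes dividing [D] are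
    left out so that [f] is separable modulo [p]. *)
Definition deg1_primes (f : {poly int}) (D : int) (x : nat) : {set 'I_x.+1 * 'I_x.+1} :=
  [set a : 'I_x.+1 * 'I_x.+1 | [&& prime a.1, ~~ (val a.1 %| D)%Z, (a.2 < a.1)%N & (val a.1 %| f.[(val a.2)%:Z])%Z]].

Definition set_norm (x : nat) (A : {set 'I_x.+1 * 'I_x.+1}) : nat := (\prod_(a in A) a.1)%N.

Definition in_lattice (x n : nat) (A : {set 'I_x.+1 * 'I_x.+1}) (c : 'rV[int]_n.+1) :=
  [forall a in A, (val a.1 %| (rVpoly c).[(val a.2)%:Z])%Z].

Lemma dvdn_squarefree (N m : nat) : (0 < N)%N ->
  (forall p, prime p -> (p %| N)%N -> (p %| m)%N && ~~ (p ^ 2 %| N)%N) -> (N %| m)%N.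
Proof.
move=> N0 H; apply/dvdn_partP => // p; rewrite mem_primes => /and3P [prp _ pN].
have /andP [pm p2] := H p prp pN; rewrite p_part.
suff -> : logn p N = 1%N by rewrite expn1.
apply/eqP; rewrite eqn_leq logn_gt0 mem_primes prp N0 pN /= andbT leqNgt.
by apply: contra p2 => l; rewrite (pfactor_dvdn _ prp N0).
Qed.

(** Here [l] is the [d]th root of [m / C] rounded up. *)
Lemma exists_root (d m C : nat) : (0 < d)%N -> (0 < C)%N -> (0 < m)%N ->
  exists l, (0 < l)%N /\ (C * l.-1 ^ d < m)%N /\ (m <= C * l ^ d)%N.
Proof.
move=> d0 C0 m0; have ex : exists l, (m <= C * l ^ d)%N.
  exists m; apply: leq_trans (leq_pmull _ C0); case: d d0 => // d _.
  by rewrite expnS leq_pmulr // expn_gt0 m0.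
case: (ex_minnP ex) => l Hl min; exists l.
have l0 : (0 < l)%N by case: l Hl {min} => //; rewrite exp0n // muln0 leqNgt m0.
split=> //; split=> //; rewrite ltnNge; apply/negP => /min; case: l l0 {Hl min} => // l _.
by rewrite /= ltnn.
Qed.

Lemma exp_succ_le (a d : nat) : (a.+1 ^ d <= 2 ^ d * (1 + a ^ d))%N.
Proof.
case: a => [|a]; first by rewrite exp1n muln_gt0 expn_gt0.
apply: (@leq_trans (2 ^ d * a.+1 ^ d)%N); last by rewrite leq_mul2l leq_addl orbT.
by rewrite -expnMn; case: d => [|d] //; rewrite leq_exp2r //; lia.
Qed.

Lemma card_ord_lt x m (S : {pred 'I_x}) : {in S, forall i : 'I_x, (i < m)%N} -> (#|S| <= m)%N.
Proof.
move=> Sm; rewrite cardE -(size_map val) -[X in (_ <= X)%N](size_iota 0).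
apply: uniq_leq_size; first by rewrite map_inj_uniq ?enum_uniq //; apply: val_inj.
by move=> _ /mapP [i + ->]; rewrite mem_enum mem_iota => /Sm.
Qed.

Lemma card_union_bound (S T : finType) (A : {set S}) (R : T -> {set S}) (B : {set T}) K :
  (forall a, a \in A -> exists2 t, t \in B & a \in R t) ->
  (forall t, t \in B -> (#|R t| <= K)%N) -> (#|A| <= K * #|B|)%N.
Proof.
move=> AR RK; apply: (@leq_trans #|\bigcup_(t in B) R t|).
  apply/subset_leq_card/subsetP => a /AR [t tB aR]; by apply/bigcupP; exists t.
apply: (@leq_trans (\sum_(t in B) #|R t|)%N).
  elim/big_rec2: _ => [|t s U _ IH]; first by rewrite cards0.
  by apply: leq_trans (leq_card_setU _ _) _; rewrite leq_add2l.
by rewrite mulnC -sum_nat_const; apply: leq_sum.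
Qed.

Section Counting.
Variables (n : nat) (f : {poly int}).
Hypotheses (f_monic : f \is monic) (size_f : size f = n.+2).
Hypothesis f_irr : irreducible_poly (map_poly (intr : int -> rat) f).
Variables (D : int) (u v : {poly int}).
Hypotheses (D0 : D != 0) (uvD : u * f + v * f^`() = D%:P).
Local Notation N := (normf f).
Local Notation P := (deg1_primes f D).

Lemma set_norm_gt0 x (A : {set 'I_x.+1 * 'I_x.+1}) : A \subset P x -> (0 < set_norm A)%N.
Proof.
move=> /subsetP sA; apply: prodn_cond_gt0 => a /sA; rewrite inE => /and4P [pr _ _ _].
exact: prime_gt0.
Qed.

Lemma logn_set_norm x (A : {set 'I_x.+1 * 'I_x.+1}) p : prime p -> A \subset P x ->
  logn p (set_norm A) = #|[set a in A | a.1 == p :> nat]|.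
Proof.
move=> prp /subsetP sA; rewrite -sum1_card.
under eq_bigl do rewrite inE; rewrite big_mkcondr /= /set_norm.
suff : (0 < \prod_(a in A) a.1)%N /\ logn p (\prod_(a in A) a.1)%N =
    (\sum_(a in A) if a.1 == p :> nat then 1 else 0)%N by case.
elim/big_rec2: _ => [|a s m /sA]; first by rewrite logn1.
rewrite inE => /and4P [pr _ _ _] [m0 <-]; split; first by rewrite muln_gt0 prime_gt0.
by rewrite (lognM _ (prime_gt0 pr) m0) (logn_prime _ pr) eq_sym; case: eqP.
Qed.

(** For each prime [p], the members of [A] above [p] are distinct common roots of [f] and [c] modulo
    [p], each worth one factor [p] of the norm. *)
Lemma set_norm_dvd x (A : {set 'I_x.+1 * 'I_x.+1}) (c : 'rV[int]_n.+1) :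
  A \subset P x -> in_lattice A c -> (set_norm A %| `|N c|)%N.
Proof.
move=> sA /forall_inP Ac; apply/dvdn_partP; first exact: set_norm_gt0.
move=> p; rewrite mem_primes => /and3P [prp _ pN].
rewrite p_part logn_set_norm //.
set Ap := [set a in A | _].
have : ~~ (p %| D)%Z.
  have : (0 < logn p (set_norm A))%N by rewrite logn_gt0 mem_primes prp pN set_norm_gt0.
  rewrite logn_set_norm // => /card_gt0P [a]; rewrite inE => /andP [aA /eqP <-].
  by have := subsetP sA _ aA; rewrite inE => /and4P [].
move=> pD; rewrite cardE -(size_map (fun a => val a.2)).
apply: (dvd_normf_roots f_monic size_f uvD prp pD).
  rewrite map_inj_in_uniq ?enum_uniq // => -[a1 a2] [b1 b2]; rewrite !mem_enum !inE /=.
  move=> /andP [_ /eqP a1p] /andP [_ /eqP b1p] /val_inj ->.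
  by congr (_, _); apply: val_inj; rewrite [LHS]a1p [RHS]b1p.
move=> _ /mapP [a + ->]; rewrite mem_enum inE => /andP [aA /eqP a1p].
rewrite -a1p; have := subsetP sA _ aA; rewrite inE => /and4P [_ _ h1 h2].
by apply/and3P; split=> //; apply: Ac.
Qed.

Lemma in_latticeB x (A : {set 'I_x.+1 * 'I_x.+1}) (c c' : 'rV[int]_n.+1) :
  in_lattice A c -> in_lattice A c' -> in_lattice A (c - c').
Proof.
move=> /forall_inP h /forall_inP h'; apply/forall_inP => a aA.
by rewrite raddfB /= hornerD hornerN rpredB // ?h ?h'.
Qed.

(** Pigeonhole: the box has more points than there are systems of residues on [A], so two of them
    differ by a lattice vector. *)
Lemma short_vector x (A : {set 'I_x.+1 * 'I_x.+1}) (Z : nat) : A \subset P x ->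
  (set_norm A < Z.+1 ^ n.+1)%N ->
  exists c : 'rV[int]_n.+1, [/\ c != 0, forall i, `|c 0 i| <= Z%:Z & in_lattice A c].
Proof.
move=> sA lt.
pose vec (a : {ffun 'I_n.+1 -> 'I_Z.+1}) : 'rV[int]_n.+1 := \row_i (val (a i))%:Z.
pose res (a : {ffun 'I_n.+1 -> 'I_Z.+1}) : {ffun 'I_x.+1 * 'I_x.+1 -> 'I_x.+1} :=
  [ffun b => if b \in A then inord `|((rVpoly (vec a)).[(val b.2)%:Z] %% val b.1)%Z|%N else ord0].
(* The dummy value [ord0] outside [A] makes the size of this family exactly [set_norm A]. *)
pose F (b : 'I_x.+1 * 'I_x.+1) : pred 'I_x.+1 :=
  if b \in A then [pred i : 'I_x.+1 | (i < b.1)%N] else pred1 ord0.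
have pos b : b \in A -> (0 < b.1)%N.
  by move=> /(subsetP sA); rewrite inE => /and4P [pr _ _ _]; apply: prime_gt0.
have rlt b a : b \in A -> (`|((rVpoly (vec a)).[(val b.2)%:Z] %% val b.1)%Z| < b.1)%N.
  move=> /pos b0; rewrite -ltz_nat gez0_abs ?ltz_pmod ?modz_ge0 //.
  by rewrite eqz_nat -lt0n.
have rE b a : b \in A -> val (res a b) = `|((rVpoly (vec a)).[(val b.2)%:Z] %% val b.1)%Z|%N.
  move=> bA; rewrite ffunE bA /= inordK //; apply: leq_trans (rlt _ _ bA) _.
  exact: ltnW (ltn_ord _).
have resF a : res a \in family F.
  apply/familyP => b; rewrite /F; case: ifP => bA; last by rewrite ffunE bA inE.
  by rewrite inE rE // rlt.
have : ~~ injectiveb res.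
  apply/negP => /injectiveP inj; move: lt; rewrite ltnNge => /negP; apply.
  have -> : (Z.+1 ^ n.+1)%N = #|{ffun 'I_n.+1 -> 'I_Z.+1}| by rewrite card_ffun !card_ord.
  rewrite -(card_codom inj) /set_norm.
  apply: (@leq_trans #|family F|).
    by apply/subset_leq_card/subsetP => _ /codomP [a ->].
  rewrite card_family foldrE big_map big_enum /= [X in (_ <= X)%N]big_mkcond /=.
  apply: leq_prod => b _; rewrite /F; case: ifP => bA; last by rewrite card1.
  by apply: card_ord_lt => i; rewrite inE.
move/injectivePn => [a [b ab E]].
exists (vec a - vec b); split.
- apply: contra ab => /eqP /rowP E'; apply/eqP/ffunP => i; apply/val_inj.
  by have := E' i; rewrite !mxE => /eqP; rewrite subr_eq0 eqz_nat => /eqP.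
- move=> i; rewrite !mxE /= ler_norml; have := ltn_ord (a i); have := ltn_ord (b i).
  by move: (nat_of_ord (a i)) (nat_of_ord (b i)) => s t st tt; apply/andP; split; lia.
- apply/forall_inP => y yA; rewrite raddfB /= hornerD hornerN.
  have := congr1 (fun g : {ffun _ -> _} => val (g y)) E; rewrite /= !rE // => /eqP.
  rewrite -eqz_nat !gez0_abs ?modz_ge0 ?eqz_nat -?lt0n ?pos //.
  by rewrite eqz_mod_dvd.
Qed.

(** A short vector [c] of the lattice of [A] has norm at most [C * set_norm A]. Such vectors lie in
    a box of [O(Y)] points, and each serves boundedly many [A]: inside the set of all degree one
    primes dividing [c], the complement of [A] has norm at most [C]. *)
Lemma count_upper : exists K : nat, (0 < K)%N /\ forall x Y, (0 < Y)%N ->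
  (#|[set A : {set _} in powerset (P x) | set_norm A <= Y]| <= K * Y)%N.
Proof.
have [C [C0 HC]] := normf_bound n f.
(* The first factor counts complements with both coordinates at most [C]; the second comes from the
   [2 * l.-1 + 1] values of each coordinate. *)
exists (2 ^ (C.+1 ^ 2) * 3 ^ n.+1)%N; split; first by rewrite muln_gt0 !expn_gt0.
move=> x Y Y0.
have [l [l0 [lY Yl]]] := exists_root (ltn0Sn n) (ltn0Sn 0) (ltn0Sn Y : (0 < Y.+1)%N).
rewrite mul1n ltnS in lY; rewrite mul1n in Yl.
pose vec (b : {ffun 'I_n.+1 -> 'I_(2 * l.-1).+1}) : 'rV[int]_n.+1 :=
  \row_i ((val (b i))%:Z - l.-1%:Z).
pose R b := [set A : {set _} in powerset (P x) |
   [&& in_lattice A (vec b), vec b != 0 & (`|N (vec b)| <= C * set_norm A)%N]].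
apply: leq_trans (card_union_bound (R := R) (B := setT) (K := 2 ^ (C.+1 ^ 2)) _ _) _.
- move=> A; rewrite inE powersetE => /andP [sA AY].
  have [m [m0 [mA Am]]] := exists_root (ltn0Sn n) (ltn0Sn 0) (ltn0Sn (set_norm A)).
  rewrite mul1n ltnS in mA; rewrite mul1n in Am.
  have [c [c0 cm cA]] : exists c : 'rV[int]_n.+1,
     [/\ c != 0, forall i, `|c 0 i| <= m.-1%:Z & in_lattice A c].
    by apply: short_vector => //; rewrite prednK.
  have ml : (m.-1 <= l.-1)%N.
    have : (m.-1 ^ n.+1 < l ^ n.+1)%N by apply: leq_ltn_trans mA _; apply: leq_ltn_trans AY _.
    by rewrite ltn_exp2r //; lia.
  have cE : vec [ffun i => inord `|(c 0 i + l.-1%:Z)%R|%N] = c.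
    apply/rowP => i; rewrite !mxE ffunE /=; have := cm i; move: (c 0 i) => ci cim.
    by rewrite inordK; lia.
  exists [ffun i => inord `|(c 0 i + l.-1%:Z)%R|%N] => //.
  rewrite inE powersetE sA cE cA c0 /=; apply: leq_trans (HC _ _ cm) _.
  by rewrite leq_mul2l mA orbT.
- move=> b _; set c := vec b.
  pose Ac := [set a in P x | (val a.1 %| (rVpoly c).[(val a.2)%:Z])%Z].
  pose T0 := [set i : 'I_x.+1 | (i <= C)%N]; pose T := setX T0 T0.
  have cT : (#|T| <= C.+1 ^ 2)%N.
    have h : (#|T0| <= C.+1)%N.
      by apply: card_ord_lt => i; rewrite inE.
    by rewrite cardsX -mulnn leq_mul.
  apply: (@leq_trans #|powerset T|); last by rewrite card_powerset leq_exp2l.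
  have sAc A : A \in R b -> A \subset Ac.
    rewrite inE powersetE => /and4P [sA /forall_inP Al _ _].
    by apply/subsetP => a aA; rewrite inE (subsetP sA) ?Al.
  (* Counting the sets [A] amounts to counting their complements in [Ac]. *)
  rewrite -(card_in_imset (f := fun A => Ac :\: A)).
    apply/subset_leq_card/subsetP => _ /imsetP [A AR ->]; rewrite powersetE.
    move: (AR); rewrite inE powersetE => /and4P [sA Al c0 NA].
    have N0 : (0 < `|N c|)%N by rewrite absz_gt0 (normf_neq0 f_monic size_f f_irr).
    have AcN : (set_norm Ac <= `|N c|)%N.
      apply: dvdn_leq => //; apply: set_norm_dvd; first by apply/subsetP => a; rewrite inE => /andP [].
      by apply/forall_inP => a; rewrite inE => /andP [].
    have E : set_norm Ac = (set_norm A * set_norm (Ac :\: A))%N.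
      by rewrite /set_norm (big_setID A) /= (setIidPr (sAc _ AR)).
    have A0 := set_norm_gt0 sA.
    have dC : (set_norm (Ac :\: A) <= C)%N.
      by rewrite -(leq_pmul2l A0) -E; apply: leq_trans AcN _; rewrite mulnC.
    apply/subsetP => a aD; have aP : a \in P x by move: aD; rewrite !inE => /and3P [].
    have a1C : (a.1 <= C)%N.
      apply: leq_trans dC; apply: dvdn_leq.
        by apply: set_norm_gt0; apply/subsetP => b'; rewrite !inE => /and3P [].
      by rewrite /set_norm (bigD1 a) //= dvdn_mulr.
    rewrite !inE a1C /=; move: aP; rewrite inE => /and4P [_ _ lt _].
    exact: leq_trans (ltnW lt) a1C.
  move=> A B AR BR E; rewrite -(setIidPr (sAc _ AR)) -(setIidPr (sAc _ BR)).
  by have := congr1 (fun X => Ac :\: X) E; rewrite /= !setDDr !setDv !set0U.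
- rewrite cardsT card_ffun !card_ord -mulnA leq_mul2l; apply/orP; right.
  case: (l.-1) lY => [|m] lY; first by rewrite exp1n muln_gt0 expn_gt0.
  apply: (@leq_trans (3 ^ n.+1 * m.+1 ^ n.+1)%N); last by rewrite leq_mul2l lY orbT.
  by rewrite -expnMn leq_exp2r //; lia.
Qed.

End Counting.

(** * Lower bound for the number of sets of bounded norm *)

Lemma sum_inv_sq (F : realFieldType) y j : (0 < y)%N ->
  \sum_(y.+1 <= i < y.+1 + j) (i%:R ^- 2 : F) <= y%:R^-1 - (y + j)%:R^-1.
Proof.
move=> y0; elim: j => [|j IH]; first by rewrite addn0 big_geq // addn0 subrr.
rewrite addnS big_nat_recr ?leq_addr //= addSn.
apply: le_trans (lerD IH (lexx _)) _.
have m0 : 0 < (y + j)%:R :> F by rewrite ltr0n addn_gt0 y0.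
rewrite addnS -[X in X <= _]addrA lerD2l -[(y + j).+1%:R]natr1.
move: ((y + j)%:R : F) m0 => m m0.
have m1 : 0 < m + 1 by lra.
rewrite -subr_ge0.
have -> : - (m + 1)^-1 - (- m^-1 + (m + 1) ^- 2) = (m * (m + 1) ^+ 2)^-1.
  by field; rewrite !gt_eqF.
by rewrite invr_ge0 mulr_ge0 ?exprn_ge0 // ltW.
Qed.

Definition box_vec n Z (a : {ffun 'I_n.+1 -> 'I_Z}) : 'rV[int]_n.+1 :=
  \row_i (val (a i))%:Z.

Section LowerCount.
Variables (n : nat) (f : {poly int}).
Hypotheses (f_monic : f \is monic) (size_f : size f = n.+2).
Hypothesis f_irr : irreducible_poly (map_poly (intr : int -> rat) f).
Variables (D : int) (u v : {poly int}).
Hypotheses (D0 : D != 0) (uvD : u * f + v * f^`() = D%:P).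
Local Notation N := (normf f).
Local Notation P := (deg1_primes f D).

(** Cut the box into cells of side [l], with [C * l.-1 ^ n.+1 < m]. Two points of [W] in one cell
    have a difference of norm below [m] and divisible by [m], hence zero, so they coincide. *)
Lemma packing (C : nat) Z (W : {set {ffun 'I_n.+1 -> 'I_Z}}) m : (0 < C)%N ->
  (forall (c : 'rV[int]_n.+1) (Z : nat), (forall i, `|c 0 i| <= Z%:Z) ->
     (`|N c| <= C * Z ^ n.+1)%N) ->
  (0 < m)%N -> {in W &, forall a b, (m %| `|N (box_vec a - box_vec b)|)%N} ->
  (#|W| * m <= 2 ^ n.+1 * (m + C * Z ^ n.+1))%N.
Proof.
move=> C0 HC m0 Wm; have [l [l0 [lm ml]]] := exists_root (ltn0Sn n) C0 m0.
have cW : (#|W| <= (Z %/ l).+1 ^ n.+1)%N.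
  pose h (a : {ffun 'I_n.+1 -> 'I_Z}) : {ffun 'I_n.+1 -> 'I_(Z %/ l).+1} :=
    [ffun i => inord (a i %/ l)].
  rewrite -(card_in_imset (f := h)).
    by apply: leq_trans (max_card _) _; rewrite card_ffun !card_ord.
  move=> a b aW bW /ffunP E; apply/eqP/negPn/negP => ab.
  have c0 : box_vec a - box_vec b != 0.
    apply: contra ab => /eqP /rowP E'; apply/eqP/ffunP => i; apply/val_inj.
    by have := E' i; rewrite !mxE => /eqP; rewrite subr_eq0 eqz_nat => /eqP.
  have : (`|N (box_vec a - box_vec b)| <= C * l.-1 ^ n.+1)%N.
    apply: HC => i; rewrite !mxE /=; have := congr1 val (E i); rewrite !ffunE /=.
    have dl (k : 'I_Z) : (k %/ l < (Z %/ l).+1)%N by rewrite ltnS leq_div2r // ltnW.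
    rewrite !inordK // => e.
    have := divn_eq (a i) l; have := divn_eq (b i) l; rewrite e.
    have := ltn_pmod (a i) l0; have := ltn_pmod (b i) l0.
    move: (nat_of_ord (a i)) (nat_of_ord (b i)) => s t.
    move: (s %% l)%N (t %% l)%N (t %/ l * l)%N => s1 t1 q h1 h2 h3 h4.
    by rewrite ler_norml; apply/andP; split; lia.
  rewrite leqNgt => /negP; apply; apply: leq_trans lm _; apply: dvdn_leq (Wm _ _ aW bW).
  by rewrite absz_gt0 (normf_neq0 f_monic size_f f_irr).
apply: (@leq_trans (2 ^ n.+1 * (1 + (Z %/ l) ^ n.+1) * m)%N).
  by rewrite leq_mul2r (leq_trans cW) ?orbT // exp_succ_le.
rewrite -mulnA leq_mul2l; apply/orP; right; rewrite mulnDl mul1n leq_add2l.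
apply: (@leq_trans ((Z %/ l) ^ n.+1 * (C * l ^ n.+1))%N); first by rewrite leq_mul2l ml orbT.
rewrite mulnCA -expnMn leq_mul2l; apply/orP; right.
by rewrite leq_exp2r // leq_trunc_div.
Qed.

Lemma box_vec_le Z (a : {ffun 'I_n.+1 -> 'I_Z}) i : `|box_vec a 0 i| <= Z%:Z.
Proof. by rewrite mxE ger0_norm // lez_nat; apply/ltnW/ltn_ord. Qed.

(** The element [t + p * a] of Z[X]/(f): a large [t] forces a large norm, and [t = 1] modulo the
    prime factors of [p] makes the norm prime to [p]. *)
Definition shifted_vec (t p Z : nat) (a : {ffun 'I_n.+1 -> 'I_Z}) : 'rV[int]_n.+1 :=
  t%:Z *: delta_mx 0 0 + p%:Z *: box_vec a.

Lemma elt_mx_shifted t p Z (a : {ffun 'I_n.+1 -> 'I_Z}) :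
  elt_mx f (shifted_vec t p a) = t%:Z%:M + p%:Z *: elt_mx f (box_vec a).
Proof.
rewrite /elt_mx /shifted_vec linearD /= rmorphD /= !linearZ /=.
by rewrite rVpoly_delta expr0 rmorph1 scalemx1.
Qed.

Lemma shifted_vecB t p Z (a b : {ffun 'I_n.+1 -> 'I_Z}) :
  shifted_vec t p a - shifted_vec t p b = p%:Z *: (box_vec a - box_vec b).
Proof. by rewrite /shifted_vec opprD addrACA subrr add0r -scalerBr. Qed.

Lemma normf_shifted_coprime t p q Z (a : {ffun 'I_n.+1 -> 'I_Z}) :
  prime q -> (q %| p)%N -> (q %| t.-1)%N -> (0 < t)%N ->
  ~~ (q %| `|N (shifted_vec t p a)|)%N.
Proof.
move=> prq qp qt t0; have qF := pchar_Fp prq.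
rewrite -[(q %| _)%N]/(q%:Z %| N (shifted_vec t p a))%Z (dvdz_pcharf qF) /normf -det_map_mx.
rewrite elt_mx_shifted map_mxD map_scalar_mx /= map_mxZ /=.
have -> : (p%:Z)%:~R = 0 :> 'F_q by apply/eqP; rewrite -(dvdz_pcharf qF).
have -> : (t%:Z)%:~R = 1 :> 'F_q.
  have -> : t%:Z = t.-1%:Z + 1 by rewrite -[in LHS](prednK t0) -addn1 PoszD.
  by rewrite rmorphD /= (_ : t.-1%:Z%:~R = 0) ?add0r //; apply/eqP; rewrite -(dvdz_pcharf qF).
by rewrite scale0r addr0 det1 oner_eq0.
Qed.

(** Each of the [n.+1 ^ 2] families of [square_lattices] is a packing problem: the shift cancels in
    differences, and the factor [p] is prime to [q]. *)
Lemma card_square_divisors (C : nat) (t p Z q : nat) : (0 < C)%N ->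
  (forall (c : 'rV[int]_n.+1) (Z : nat), (forall i, `|c 0 i| <= Z%:Z) ->
     (`|N c| <= C * Z ^ n.+1)%N) ->
  prime q -> ~~ (q %| D)%Z -> ~~ (q %| p)%N ->
  (#|[set a : {ffun 'I_n.+1 -> 'I_Z} | q ^ 2 %| `|N (shifted_vec t p a)|]| * q ^ 2
    <= n.+1 ^ 2 * 2 ^ n.+1 * (q ^ 2 + C * Z ^ n.+1))%N.
Proof.
move=> C0 HC prq qD qp.
have [Lam [LB LP LN Lcov]] := square_lattices f_monic size_f uvD prq qD.
pose W k := [set a : {ffun 'I_n.+1 -> 'I_Z} | `[< Lam k (shifted_vec t p a) >]].
have q0 : (0 < q ^ 2)%N by rewrite expn_gt0 prime_gt0.
have cW k : (#|W k| <= (2 ^ n.+1 * (q ^ 2 + C * Z ^ n.+1)) %/ q ^ 2)%N.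
  rewrite leq_divRL //; apply: packing => // a b; rewrite !inE => /asboolP la /asboolP lb.
  apply: (LN k); apply: (LP k p%:Z) => //; rewrite -(shifted_vecB t); exact: LB.
apply: (@leq_trans ((2 ^ n.+1 * (q ^ 2 + C * Z ^ n.+1)) %/ q ^ 2 * #|[set: 'I_n.+1 * 'I_n.+1]| * q ^ 2)%N).
  rewrite leq_mul2r; apply/orP; right.
  apply: (card_union_bound (R := W)) => // a; rewrite inE => /Lcov [k kL].
  by exists k; rewrite // inE; apply/asboolP.
rewrite mulnAC cardsT card_prod card_ord mulnn [X in (X <= _)%N]mulnC -[X in (_ <= X)%N]mulnA leq_mul2l.
by rewrite leq_trunc_div orbT.
Qed.

(** A squarefree sieve. Small primes are excluded by the shape of the vectors, and the squares of
    large primes spoil at most half of the box. Each remaining vector has squarefree norm, equal to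
    the norm of the set of degree one primes dividing it, and each set arises boundedly often. *)
Lemma count_lower_box : exists U K Z0 : nat, [/\ (0 < U)%N, (0 < K)%N &
  forall x Y Z, (Z0 <= Z ^ n.+1)%N -> (0 < Z)%N -> (U * Z ^ n.+1 <= Y)%N -> (Y <= x)%N ->
  (Z ^ n.+1 <= K * #|[set A : {set _} in powerset (P x) | set_norm A <= Y]|)%N].
Proof.
have [C [C0 HC]] := normf_bound n f.
have [E [E0 HE]] := elt_mx_bound n f.
pose K1 := (n.+1 ^ 2 * 2 ^ n.+1)%N.
(* Primes above [y] do not divide [D], and the tail of the sum of inverse squares beyond [y] costs
   at most a quarter of the box. *)
pose y := (4 * K1 * C + `|D|)%N.
pose p := y`!.
pose H := (2 + n.+1`! * 2 ^ n)%N.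
pose U1 := (1 + p * H * E + p)%N.
pose U := (C * U1 ^ n.+1)%N.
have K10 : (0 < K1)%N by rewrite muln_gt0 !expn_gt0.
have p0 : (0 < p)%N by apply: fact_gt0.
have y0 : (0 < y)%N by rewrite addn_gt0 2!muln_gt0 K10 C0.
have U0 : (0 < U)%N by rewrite muln_gt0 C0 expn_gt0.
(* [U] bounds the norms; the second constant is 2 for the spoiled half times the fibre size; the
   third makes the error [K1 * s] at most a quarter of the box. *)
exists U, (2 * (2 ^ n.+1 * (1 + C)))%N, (16 * K1 ^ 2 * U)%N; split=> //.
  by rewrite !muln_gt0 expn_gt0.
move=> x Y Z HZ Z0 UY Yx.
pose t := (1 + p * (H * E * Z))%N.
pose c (a : {ffun 'I_n.+1 -> 'I_Z}) := shifted_vec t p a.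
have Nlow a : (Z ^ n.+1 <= `|N (c a)|)%N.
  have : ((p * E * Z) ^ n.+1)%N%:Z <= N (c a).
    rewrite /normf elt_mx_shifted; apply: det_diag_dominant.
      move=> i j; rewrite mxE normrM ger0_norm // -mulnA PoszM ler_wpM2l //.
      by apply: HE => k; apply: box_vec_le.
    rewrite /t /H; lia.
  move=> h; rewrite -lez_nat gez0_abs; last exact: le_trans h.
  apply: le_trans h; rewrite lez_nat leq_exp2r // leq_pmull // muln_gt0 p0 //.
have Nup a : (`|N (c a)| <= U * Z ^ n.+1)%N.
  rewrite /U -mulnA -expnMn; apply: HC => i; rewrite !mxE.
  apply: le_trans (ler_normD _ _) _; rewrite !normrM !ger0_norm //.
  have h1 (b : bool) : t%:Z * b%:R <= t%:Z by case: b; rewrite ?mulr1 ?mulr0.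
  have h2 : p%:Z * (val (a i))%:Z <= p%:Z * Z%:Z.
    by rewrite ler_wpM2l // lez_nat; apply/ltnW/ltn_ord.
  apply: le_trans (lerD (h1 _) h2) _.
  rewrite -PoszM -PoszD lez_nat /t /U1; clearbody H p; lia.
(* A prime whose square divides one of the norms is at most [s]. *)
have [s [s1 s2]] : exists s, (s ^ 2 <= U * Z ^ n.+1)%N /\ (U * Z ^ n.+1 < s.+1 ^ 2)%N.
  have [l [l0 [h1 h2]]] := exists_root (isT : (0 < 2)%N) (isT : (0 < 1)%N) (ltn0Sn (U * Z ^ n.+1)).
  by exists l.-1; rewrite prednK //; move: h1 h2; rewrite !mul1n ltnS.
have Ks : (4 * K1 * s <= Z ^ n.+1)%N.
  rewrite -(@leq_exp2r _ _ 2) // expnMn; apply: (@leq_trans ((4 * K1) ^ 2 * (U * Z ^ n.+1))%N).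
    by rewrite leq_mul2l s1 orbT.
  rewrite mulnA expnMn -[X in (_ <= X)%N]mulnn leq_mul2r; apply/orP; right; exact: HZ.
pose Bd q := [set a | q ^ 2 %| `|N (c a)|]%N.
pose Bad := \bigcup_(q < s.+1 | prime q && (y < q)%N) Bd q.
have y_D q : prime q -> (y < q)%N -> ~~ (q %| D)%Z.
  move=> prq yq; apply/negP; rewrite dvdzE => /dvdn_leq; rewrite absz_gt0 => /(_ D0).
  by move: yq; rewrite /y; lia.
have y_p q : prime q -> (y < q)%N -> ~~ (q %| p)%N.
  move=> prq yq; apply/negP; rewrite /p fact_prod Euclid_dvd_prod // big_has => /hasP [i].
  rewrite mem_index_iota => /andP [i1 iy] /dvdn_leq => /(_ i1); lia.
have cBad : (2 * #|Bad| <= Z ^ n.+1)%N.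
  have h1 : (#|Bad| <= \sum_(q < s.+1 | prime q && (y < q)) #|Bd q|)%N.
    rewrite /Bad; elim/big_rec2: _ => [|q k X _ IH]; first by rewrite cards0.
    by apply: leq_trans (leq_card_setU _ _) _; rewrite leq_add2l.
  have h2 (q : nat) : prime q && (y < q)%N ->
     (#|Bd q|%:R : rat) <= K1%:R + K1%:R * (C * Z ^ n.+1)%N%:R * q%:R ^- 2.
    move=> /andP [prq yq].
    have := card_square_divisors t Z C0 HC prq (y_D q prq yq) (y_p q prq yq).
    rewrite -/(Bd q) -/K1 -(ler_nat rat) natrM [X in _ <= X]natrM natrD !natrX => h.
    have q0 : 0 < q%:R ^+ 2 :> rat by rewrite exprn_gt0 // ltr0n prime_gt0.
    rewrite -(ler_pM2r q0); apply: le_trans h _.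
    by rewrite [X in _ <= X]mulrDl mulrDr mulfVK ?gt_eqF.
  have h3 : (#|Bad|%:R : rat) <= K1%:R * s%:R + K1%:R * (C * Z ^ n.+1)%N%:R * y%:R^-1.
    apply: le_trans (_ : _ <= (\sum_(q < s.+1 | prime q && (y < q)) #|Bd q|)%N%:R) _.
      by rewrite ler_nat.
    rewrite natr_sum; apply: le_trans (ler_sum _ (fun (q : 'I_s.+1) Hq => h2 q Hq)) _.
    rewrite big_split /=; apply: lerD.
      rewrite sumr_const -[X in X <= _]mulr_natr ler_wpM2l // ler_nat.
      apply: (@leq_trans #|predC1 (ord0 : 'I_s.+1)|); last by rewrite cardC1 card_ord.
      apply/subset_leq_card/subsetP => q; rewrite !inE => /andP [_ yq].
      by rewrite -val_eqE /= -lt0n (leq_trans _ yq).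
    rewrite -mulr_sumr; apply: ler_wpM2l; first by rewrite mulr_ge0.
    apply: (@le_trans _ _ (\sum_(y.+1 <= q < s.+1) (q%:R ^- 2 : rat))).
      rewrite big_geq_mkord /= [X in X <= _]big_mkcond [X in _ <= X]big_mkcond /=.
      apply: ler_sum => q _; case: (prime q); case: (y < q)%N => //=.
      by rewrite invr_ge0 exprn_ge0.
    have [sy|ys] := leqP s.+1 y.+1; first by rewrite big_geq ?invr_ge0.
    have := sum_inv_sq rat (s.+1 - y.+1) y0; rewrite subnKC ?(ltnW ys) //.
    by move/le_trans; apply; rewrite lerBlDr lerDl invr_ge0.
  rewrite -(ler_nat rat) natrM.
  have h4 : 4 * (K1%:R * s%:R) <= (Z ^ n.+1)%N%:R :> rat.
    by rewrite mulrA -!natrM ler_nat.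
  have h5 : 4 * (K1%:R * (C * Z ^ n.+1)%N%:R * y%:R^-1) <= (Z ^ n.+1)%N%:R :> rat.
    have y0' : 0 < y%:R :> rat by rewrite ltr0n.
    rewrite mulrA ler_pdivrMr // -!natrM ler_nat.
    apply: (@leq_trans (Z ^ n.+1 * (4 * K1 * C))%N); first by lia.
    by rewrite leq_mul2l leq_addr orbT.
  lra.
pose Good := ~: Bad.
have goodP a q : a \in Good -> prime q -> (q %| `|N (c a)|)%N ->
    (y < q)%N && ~~ (q ^ 2 %| `|N (c a)|)%N.
  move=> aG prq qN; have N0 : (0 < `|N (c a)|)%N.
    by apply: leq_trans (Nlow a); rewrite expn_gt0 Z0.
  have yq : (y < q)%N.
    rewrite ltnNge; apply: contraL qN => qy.
    have qp : (q %| p)%N by rewrite dvdn_fact // prime_gt0.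
    by apply: normf_shifted_coprime; rewrite // /t add1n /= dvdn_mulr.
  rewrite yq; apply: contraL aG => qq; rewrite inE negbK.
  have qs : (q < s.+1)%N.
    rewrite -(@ltn_exp2r _ _ 2) //; apply: leq_ltn_trans (dvdn_leq N0 qq) _.
    exact: leq_ltn_trans (Nup a) s2.
  by apply/bigcupP; exists (Ordinal qs); rewrite /= ?prq ?yq // inE.
pose As a := [set b in P x | (val b.1 %| (rVpoly (c a)).[(val b.2)%:Z])%Z].
have sAs a : As a \subset P x by apply/subsetP => b; rewrite inE => /andP [].
have lAs a : in_lattice (As a) (c a) by apply/forall_inP => b; rewrite inE => /andP [].
(* Every prime factor of a good norm is simple and exceeds [y], so it yields a common root, that is,
   a member of [As a]. *)
have AsN a : a \in Good -> set_norm (As a) = `|N (c a)|%N.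
  move=> aG; apply/eqP; rewrite eqn_dvd (set_norm_dvd f_monic size_f uvD) //=.
  have N0 : (0 < `|N (c a)|)%N by apply: leq_trans (Nlow a); rewrite expn_gt0 Z0.
  apply: dvdn_squarefree => // q prq qN.
  have /andP [yq qq] := goodP a q aG prq qN; rewrite qq andbT.
  have [r /and3P [rq fr cr]] := root_of_norm_prime f_monic size_f uvD prq (y_D q prq yq) qN qq.
  have qx : (q < x.+1)%N.
    rewrite ltnS; apply: leq_trans (dvdn_leq N0 qN) _.
    exact: leq_trans (Nup a) (leq_trans UY Yx).
  have rx : (r < x.+1)%N by apply: leq_trans rq (ltnW qx).
  rewrite /set_norm (bigD1 (Ordinal qx, Ordinal rx)) /= ?dvdn_mulr //.
  by rewrite !inE /= prq rq fr cr (y_D q prq yq).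
(* Good points with the same set differ by vectors of its lattice, once [p] is cancelled; the
   packing bound applies with [m] the norm of the set, which is at least the size of the box. *)
have fib A : (#|[set a in Good | As a == A]| <= 2 ^ n.+1 * (1 + C))%N.
  set W := [set a in Good | _]; have [->|[a0 a0W]] := set_0Vmem W; first by rewrite cards0.
  move: (a0W); rewrite inE => /andP [a0G /eqP EA].
  have m1 : (Z ^ n.+1 <= set_norm A)%N by rewrite -EA AsN.
  have m0 : (0 < set_norm A)%N by apply: leq_trans m1; rewrite expn_gt0 Z0.
  rewrite -(leq_pmul2r m0); apply: leq_trans (packing C0 HC m0 _) _.
    move=> a b; rewrite inE => /andP [aG /eqP aA]; rewrite inE => /andP [bG /eqP bA].
    apply: (set_norm_dvd f_monic size_f uvD); first by rewrite -aA.
    have la : in_lattice A (c a) by rewrite -{1}aA.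
    have lb : in_lattice A (c b) by rewrite -{1}bA.
    have := in_latticeB la lb; rewrite shifted_vecB => /forall_inP h.
    apply/forall_inP => z zA; have := h z zA; rewrite linearZ /= hornerZ Gauss_dvdzr //.
    have zP : z \in P x by apply: (subsetP (sAs a)); rewrite aA.
    have prz : prime z.1 by move: zP; rewrite inE => /and4P [].
    have zN : (z.1 %| `|N (c a)|)%N.
      by rewrite -AsN // aA /set_norm (bigD1 z) //= dvdn_mulr.
    have /andP [yz _] := goodP a z.1 aG prz zN.
    by rewrite /coprimez /gcdz /= eqz_nat -/(coprime _ _) prime_coprime // y_p.
  by rewrite -mulnA leq_mul2l mulnDl mul1n leq_add2l leq_mul2l m1 !orbT.
have cGood : (#|Good| <= 2 ^ n.+1 * (1 + C) *
    #|[set A : {set _} in powerset (P x) | set_norm A <= Y]|)%N.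
  apply: (card_union_bound (R := fun A => [set a in Good | As a == A])) => // a aG.
  exists (As a); last by rewrite inE aG eqxx.
  by rewrite inE powersetE sAs AsN //; apply: leq_trans (Nup a) UY.
have := cardsC Bad; rewrite card_ffun !card_ord -/Good => cB.
rewrite -mulnA; apply: (@leq_trans (2 * #|Good|)%N); last by rewrite leq_mul2l cGood.
move: cBad; rewrite -cB; move: #|Bad| #|Good| => b g; lia.
Qed.

(** Use the largest box with [U * Z ^ n.+1 <= Y]; passing from [Z] to [Z.+1] loses only a constant
    factor. *)
Lemma count_lower : exists K Y0 : nat, (0 < K)%N /\ forall x Y, (Y0 <= Y)%N -> (Y <= x)%N ->
  (Y <= K * #|[set A : {set _} in powerset (P x) | set_norm A <= Y]|)%N.
Proof.
have [U [K [Z0 [U0 K0 HZ]]]] := count_lower_box.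
exists (U * (2 ^ n.+1 * 2) * K)%N, (U * (2 ^ n.+1 * (1 + Z0.+1)))%N; split.
  by rewrite !muln_gt0 U0 expn_gt0 K0.
move=> x Y YY Yx.
have [l [l0 [h1 h2]]] := exists_root (ltn0Sn n) U0 (ltn0Sn Y).
rewrite ltnS in h1.
have h3 : (Y < U * (2 ^ n.+1 * (1 + l.-1 ^ n.+1)))%N.
  apply: leq_trans h2 _; rewrite leq_mul2l -{1}(prednK l0) exp_succ_le orbT //.
have lZ : (Z0.+1 < l.-1 ^ n.+1)%N.
  rewrite -(ltn_add2l 1) -(@ltn_pmul2l (2 ^ n.+1)) ?expn_gt0 // -(@ltn_pmul2l U) //.
  exact: leq_ltn_trans YY h3.
have l1 : (0 < l.-1)%N by case: (l.-1) lZ; rewrite ?exp0n.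
have := HZ x Y l.-1 (ltnW (ltnW lZ)) l1 h1 Yx => h4.
apply: (leq_trans (ltnW h3)); rewrite -mulnA -!mulnA leq_mul2l; apply/orP; right.
rewrite leq_mul2l; apply/orP; right.
apply: (@leq_trans (2 * l.-1 ^ n.+1)%N); last by rewrite leq_mul2l h4 orbT.
by rewrite mul2n -addnn leq_add2r (leq_trans _ lZ).
Qed.

End LowerCount.

(** * The weighted average of the number of roots *)

Section Weight.
Variable R : realType.

(** The extra exponent makes sums over all [n] converge, while [n ^ (1 / ln x)] is at most [e] for
    [n <= x]. *)
Definition wt (x n : nat) : R := n%:R `^ (- (1 + (ln (x%:R : R))^-1)).

Lemma wt_gt0 x n : (0 < n)%N -> 0 < wt x n.
Proof. by move=> n0; rewrite powR_gt0 // ltr0n. Qed.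

Lemma wt_ge0 x n : 0 <= wt x n.
Proof. exact: powR_ge0. Qed.

Lemma wt1 x : wt x 1 = 1.
Proof. by rewrite /wt powR1. Qed.

Lemma wtM x m n : wt x (m * n) = wt x m * wt x n.
Proof. by rewrite /wt natrM powRM. Qed.

Lemma wtX x m n : wt x (m ^ n) = wt x m ^+ n.
Proof. by elim: n => [|n IH]; rewrite ?wt1 // expnS wtM IH exprS. Qed.

Lemma wt_prod x (I : finType) (A : {set I}) (F : I -> nat) :
  wt x (\prod_(i in A) F i)%N = \prod_(i in A) wt x (F i).
Proof. by rewrite (big_morph (wt x) (id1 := 1) (op1 := *%R)) // => [a b|]; rewrite ?wtM ?wt1. Qed.

Variable x : nat.
Hypothesis lnx : 1 <= ln (x%:R : R).

Lemma exponent_ge1 : 1 <= 1 + (ln (x%:R : R))^-1.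
Proof. by rewrite lerDl invr_ge0 (le_trans _ lnx). Qed.

Lemma wt_le m n : (0 < m)%N -> (m <= n)%N -> wt x n <= wt x m.
Proof.
move=> m0 mn; rewrite /wt !powRN lef_pV2 ?posrE ?powR_gt0 ?ltr0n //; last exact: leq_trans mn.
apply: ge0_ler_powR; rewrite ?nnegrE ?ler_nat //.
exact: le_trans exponent_ge1.
Qed.

Lemma wt_le_inv n : (0 < n)%N -> wt x n <= n%:R^-1.
Proof.
move=> n0; rewrite /wt powRN lef_pV2 ?posrE ?powR_gt0 ?ltr0n //.
by apply: le1r_powR; rewrite ?exponent_ge1 // ler1n.
Qed.

Lemma wt_le1 n : (0 < n)%N -> wt x n <= 1.
Proof.
move=> n0; apply: le_trans (wt_le_inv n0) _.
by rewrite invf_le1 ?ltr0n // ler1n.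
Qed.

Lemma wt_ge n : (0 < n)%N -> (n <= x)%N -> expR (-1) / n%:R <= wt x n.
Proof.
move=> n0 nx; have nR : 0 < n%:R :> R by rewrite ltr0n.
rewrite /wt opprD powRD; last by rewrite (gt_eqF nR) implybT.
rewrite powR_inv1 ?ler0n // mulrC ler_pM2l ?invr_gt0 //.
rewrite /powR gt_eqF // ler_expR mulNr lerN2 mulrC ler_pdivrMr ?mul1r.
  by rewrite ler_ln ?posrE // ?ler_nat // ltr0n (leq_trans n0).
exact: lt_le_trans lnx.
Qed.

(** The ratio is [expR (- y)] with [y = ln 2 / ln x], and it is at most [1 / (1 + y)]; so the sum is
    at most [1 + 1 / y]. *)
Lemma sum_geom_wt2 J : \sum_(j < J) (2 * wt x 2) ^+ j <= (1 + (ln 2)^-1) * ln (x%:R : R).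
Proof.
have l0 : 0 < ln (x%:R : R) by apply: lt_le_trans lnx.
have l2 : 0 < ln (2 : R) by rewrite ln_gt0 // ltr1n.
set y := ln 2 / ln (x%:R : R).
have y0 : 0 < y by rewrite divr_gt0.
have E : 2 * wt x 2 = expR (- y).
  rewrite /wt opprD powRD ?pnatr_eq0 ?implybT // powR_inv1 // mulrA mulfV ?pnatr_eq0 // mul1r.
  by rewrite /powR pnatr_eq0 /= /y mulNr mulrC.
rewrite E; set r := expR (- y).
have r1 : r < 1 by rewrite expR_lt1 oppr_lt0.
have r0 : 0 < r by apply: expR_gt0.
have S : (1 - r) * \sum_(j < J) r ^+ j = 1 - r ^+ J.
  by have := subrX1 r J; rewrite -[1 - r]opprB mulNr => <-; rewrite opprB.
have : (1 - r) * \sum_(j < J) r ^+ j <= 1 by rewrite S lerBlDr lerDl exprn_ge0 // ltW.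
rewrite -ler_pdivlMl ?subr_gt0 // mulr1 => /le_trans; apply.
have h : r <= (1 + y)^-1.
  by rewrite /r expRN lef_pV2 ?posrE ?expR_gt0 ?expR_ge1Dx //; lra.
have h2 : y / (1 + y) <= 1 - r.
  have -> : y / (1 + y) = 1 - (1 + y)^-1 by field; lra.
  by lra.
have y1 : 0 < 1 + y by lra.
have : (1 - r)^-1 <= (y / (1 + y))^-1.
  by rewrite lef_pV2 ?posrE ?divr_gt0 // subr_gt0.
move/le_trans; apply; rewrite invf_div.
have -> : (1 + y) / y = y^-1 + 1 by field; lra.
rewrite /y invf_div mulrDl mul1r addrC lerD // mulrC //.
Qed.

End Weight.

(** * From counting functions to weighted sums *)

Lemma harmonic_ge_ln (R : realType) m n : (m <= n)%N ->
  ln (n.+1%:R : R) - ln (m.+1%:R : R) <= \sum_(m <= Y < n) Y.+1%:R^-1.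
Proof.
move=> mn; rewrite -(subnKC mn); elim: (n - m)%N => [|j IH].
  by rewrite addn0 big_geq // subrr.
rewrite addnS big_nat_recr ?leq_addr //=; set k := (m + j)%N in IH *.
have k0 : 0 < k.+1%:R :> R by rewrite ltr0n.
have -> : ln (k.+2%:R : R) = ln k.+1%:R + ln (1 + k.+1%:R^-1).
  rewrite -lnM ?posrE //; first by rewrite mulrDr mulr1 mulfV ?gt_eqF // natr1.
  by rewrite addr_gt0 // invr_gt0.
rewrite -addrA [_ - ln _]addrC addrA lerD //; apply: le_ln1Dx.
by apply: lt_trans (_ : 0 < _); rewrite ?ltrN10 // invr_gt0.
Qed.

Section SumOverSets.
Variable R : realType.
Variables (T : finType) (S : {set T}) (nu : T -> nat) (K x : nat).
Hypothesis lnx : 1 <= ln (x%:R : R).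
Hypothesis nu_gt0 : {in S, forall A, (0 < nu A)%N}.

(** Dyadic decomposition: at most [K * 2 ^ j.+1] sets have [nu] between [2 ^ j] and [2 ^ j.+1], each
    of weight at most [wt R x 2 ^+ j]. *)
Lemma sum_wt_upper :
  (forall Y, (0 < Y)%N -> (#|[set A in S | nu A <= Y]| <= K * Y)%N) ->
  \sum_(A in S) wt R x (nu A) <= 2 * K%:R * (1 + (ln 2)^-1) * ln (x%:R : R).
Proof.
move=> HK; pose J := (\max_(A in S) trunc_log 2 (nu A)).+1.
have tl A : A \in S -> (trunc_log 2 (nu A) < J)%N.
  by move=> AS; rewrite ltnS (leq_bigmax_cond (F := fun A => trunc_log 2 (nu A))).
apply: (@le_trans _ _ (\sum_(A in S) \sum_(j < J | trunc_log 2 (nu A) == j) wt R x (2 ^ j))).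
  apply: ler_sum => A AS; rewrite (big_pred1 (Ordinal (tl A AS))).
    apply: wt_le => //; first by rewrite expn_gt0.
    by have := trunc_log_bounds (isT : (1 < 2)%N) (nu_gt0 AS) => /andP [].
  by move=> j; rewrite eq_sym.
rewrite (exchange_big_dep xpredT) //=.
apply: (@le_trans _ _ (\sum_(j < J) 2 * K%:R * (2 * wt R x 2) ^+ j)).
  apply: ler_sum => j _; rewrite sumr_const wtX exprMn -[X in X <= _]mulr_natl.
  rewrite mulrA; apply: ler_wpM2r; first by rewrite exprn_ge0 //; apply: ltW; apply: wt_gt0.
  rewrite -natrX -!natrM ler_nat.
  apply: leq_trans (_ : (_ <= #|[set A in S | nu A <= 2 ^ j.+1]|)%N) _.
    apply/subset_leq_card/subsetP => A; rewrite !inE => /andP [AS /eqP tlj].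
    rewrite AS /= -tlj; apply: ltnW.
    by have := trunc_log_bounds (isT : (1 < 2)%N) (nu_gt0 AS) => /andP [].
  by apply: leq_trans (HK _ _) _; rewrite ?expn_gt0 // expnS; lia.
rewrite -mulr_sumr -[X in _ <= X]mulrA; apply: ler_wpM2l; first by rewrite mulr_ge0.
exact: sum_geom_wt2.
Qed.

(** Partial summation: for [nu A <= x] the weight is at least [1 / (e * nu A)], which dominates the
    telescoping sum of [g Y = 1 / (Y * Y.+1)] over [nu A <= Y < x]. After exchanging the sums, the
    count bound leaves a harmonic sum. *)
Lemma sum_wt_lower Y0 : (0 < Y0)%N -> (Y0 <= x)%N -> (0 < K)%N ->
  (forall Y, (Y0 <= Y)%N -> (Y <= x)%N -> (Y <= K * #|[set A in S | nu A <= Y]|)%N) ->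
  expR (-1) / K%:R * (ln (x%:R : R) - ln (Y0.+1%:R : R)) <= \sum_(A in S) wt R x (nu A).
Proof.
move=> Y00 Y0x K0 HK.
have K0' : 0 < K%:R :> R by rewrite ltr0n.
pose g (Y : nat) : R := Y%:R^-1 - Y.+1%:R^-1.
have gE Y : (0 < Y)%N -> g Y = (Y%:R * Y.+1%:R)^-1.
  move=> Y1; rewrite /g -natr1; have : 0 < Y%:R :> R by rewrite ltr0n.
  by move: (Y%:R : R) => z z0; field; lra.
have g0 Y : (0 < Y)%N -> 0 <= g Y by move=> Y1; rewrite gE // invr_ge0 mulr_ge0.
have s1 A : A \in S ->
    expR (-1) * \sum_(Y < x | (Y0 <= Y)%N && (nu A <= Y)%N) g Y <= wt R x (nu A).
  move=> AS; have nA := nu_gt0 AS; rewrite -(big_geq_mkord _ _ (fun Y => (Y0 <= Y)%N)).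
  have [nx|xn] := leqP (nu A) x; last first.
    by rewrite big_geq ?mulr0 ?ltW ?wt_gt0 // ltnW.
  apply: le_trans (wt_ge lnx nA nx); rewrite ler_pM2l ?expR_gt0 //.
  apply: (@le_trans _ _ (\sum_(nu A <= Y < x) g Y)).
    rewrite big_mkcond /=; apply: ler_sum_nat => Y /andP [nY _].
    by case: ifP => // _; apply: g0; apply: leq_trans nY.
  rewrite (eq_bigr (fun Y : nat => - Y.+1%:R^-1 - - Y%:R^-1)); last first.
    by move=> Y _; rewrite opprK addrC.
  rewrite (telescope_sumr (fun Y : nat => - (Y%:R : R)^-1)) // opprK.
  by rewrite gerDr oppr_le0 invr_ge0.
apply: (@le_trans _ _ (\sum_(A in S) expR (-1) *
    \sum_(Y < x | (Y0 <= Y)%N && (nu A <= Y)%N) g Y)); last first.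
  by apply: ler_sum => A; apply: s1.
rewrite -mulr_sumr -mulrA ler_pM2l ?expR_gt0 //.
rewrite (exchange_big_dep (fun Y : 'I_x => (Y0 <= Y)%N)) /=; last by move=> A Y _ /andP [].
apply: (@le_trans _ _ (\sum_(Y < x | (Y0 <= Y)%N) K%:R^-1 * Y.+1%:R^-1)); last first.
  apply: ler_sum => Y YY; have Y1 : (0 < Y)%N by apply: leq_trans YY.
  rewrite (eq_bigl (fun A => A \in [set A in S | nu A <= Y]%N)); last first.
    by move=> A; rewrite inE YY.
  rewrite sumr_const -[X in _ <= X]mulr_natl gE // invfM mulrA.
  rewrite ler_pM2r ?invr_gt0 ?ltr0n // ler_pdivlMr ?ltr0n // ler_pdivrMl //.
  by rewrite -natrM ler_nat HK // ltnW.
rewrite -mulr_sumr ler_pM2l ?invr_gt0 //.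
apply: (@le_trans _ _ (\sum_(Y0 <= Y < x) Y.+1%:R^-1)); last by rewrite big_geq_mkord.
apply: le_trans (harmonic_ge_ln _ Y0x); rewrite lerD2r ler_ln ?posrE ?ltr0n ?ler_nat //.
exact: leq_trans Y0x.
Qed.
End SumOverSets.

(** * Mertens asymptotics for root counts *)

Definition nb_roots (f : {poly int}) (p : nat) : nat :=
  #|[set r : 'I_p | (p %| f.[(val r)%:Z])%Z]|.

Lemma nb_roots_le n f p : prime p -> f \is monic -> size f = n.+2 -> (nb_roots f p <= n.+1)%N.
Proof.
move=> prp fm sf; have pF := pchar_Fp prp.
set g := map_poly (intr : int -> 'F_p) f.
have g0 : g != 0 by apply: monic_neq0; rewrite monic_map.
have sg : size g = n.+2 by rewrite size_map_poly_id0 // (monicP fm) oner_neq0.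
rewrite -ltnS -sg /nb_roots cardE.
rewrite -(size_map (fun r : 'I_p => (val r)%:Z%:~R : 'F_p)); apply: max_poly_roots => //.
  apply/allP => _ /mapP [r + ->]; rewrite mem_enum inE => pr.
  by rewrite rootE horner_map_intr -(dvdz_pcharf pF).
rewrite map_inj_uniq ?enum_uniq // => r s /eqP.
rewrite (intr_pchar_eq _ _ pF) -eqz_mod_dvd !modz_nat eqz_nat !modn_small ?ltn_ord //.
by move=> /eqP /val_inj.
Qed.

Lemma prod_1D_powerset (R : comNzRingType) (T : finType) (S : {set T}) (g : T -> R) :
  \prod_(a in S) (1 + g a) = \sum_(A in powerset S) \prod_(a in A) g a.
Proof.
rewrite big_mkcond /= (eq_bigr (fun a => (if a \in S then g a else 0) + 1)); last first.
  by move=> a _; case: ifP; rewrite ?add0r // addrC.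
rewrite bigA_distr /= [RHS]big_mkcond /= [LHS]big_mkcond /=; apply: eq_bigr => A _.
rewrite powersetE; case: ifP => [/subsetP sA|nA].
  by rewrite [RHS]big_mkcond /=; apply: eq_bigr => a _; case: ifP => // /sA ->.
have /subsetPn [a aA aS] := negbT nA.
by rewrite (bigD1 a) //= aA (negPf aS) mul0r.
Qed.

Lemma ln_nat_large (R : realType) (B : R) :
  exists x0 : nat, (0 < x0)%N /\ forall x, (x0 <= x)%N -> B <= ln (x%:R : R).
Proof.
exists (Num.bound (expR B)).+1; split=> // x xx.
have h : expR B <= x%:R.
  apply: le_trans (ltW (archi_boundP (expR_ge0 B))) _.
  by rewrite ler_nat ltnW.
by rewrite -[B](expRK) ler_ln ?posrE ?expR_gt0 // (lt_le_trans (expR_gt0 B)).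
Qed.

Lemma expR_le_1D (R : realType) (w : R) : 0 <= w -> expR (w - w ^+ 2) <= 1 + w.
Proof.
move=> w0; have w1 : 0 < 1 + w by lra.
apply: (@le_trans _ _ (expR (w / (1 + w)))).
  rewrite ler_expR ler_pdivlMr //.
  have -> : (w - w ^+ 2) * (1 + w) = w - w ^+ 3 by ring.
  by rewrite lerBlDr lerDl exprn_ge0.
have := expR_ge1Dx (- (w / (1 + w))).
have -> : 1 - w / (1 + w) = (1 + w)^-1 by field; lra.
by rewrite expRN lef_pV2 ?posrE ?expR_gt0.
Qed.

Lemma ler_sum_subset (R : realFieldType) (I : finType) (P Q : pred I) (F : I -> R) :
  (forall i, P i -> Q i) -> (forall i, Q i -> 0 <= F i) ->
  \sum_(i | P i) F i <= \sum_(i | Q i) F i.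
Proof.
move=> PQ F0; rewrite [X in X <= _]big_mkcond [X in _ <= X]big_mkcond /=.
apply: ler_sum => i _; by case: ifP => [/PQ ->|_] //; case: ifP => // /F0.
Qed.

Section RootsMertens.
Variables (R : realType) (n : nat) (f : {poly int}).
Hypotheses (f_monic : f \is monic) (size_f : size f = n.+2).
Hypothesis f_irr : irreducible_poly (map_poly (intr : int -> rat) f).

Lemma sum_deg1_primes (D : int) x (F : nat -> R) :
  \sum_(a in deg1_primes f D x) F a.1 =
  \sum_(p < x.+1 | prime p && ~~ (val p %| D)%Z) (nb_roots f p)%:R * F p.
Proof.
rewrite (eq_bigl (fun a : 'I_x.+1 * 'I_x.+1 => (prime a.1 && ~~ (val a.1 %| D)%Z) &&
   ((val a.1 %| f.[(val a.2)%:Z])%Z && (a.2 < a.1)%N))); last first.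
  move=> a; rewrite inE; case: (prime a.1) => //=; case: (_ \notin _) => //=.
  by rewrite andbC.
rewrite -(pair_big_dep (fun p : 'I_x.+1 => prime p && ~~ (val p %| D)%Z)
  (fun p r : 'I_x.+1 => (val p %| f.[(val r)%:Z])%Z && (r < p)%N) (fun p _ => F p)) /=.
apply: eq_bigr => p _; rewrite sumr_const mulr_natl; congr (_ *+ _).
rewrite -sum1_card -(big_ord_widen_cond x.+1 (fun r : nat => (val p %| f.[r%:Z])%Z) (fun=> 1%N)).
  by rewrite sum1dep_card.
exact: ltnW (ltn_ord p).
Qed.

Theorem roots_mertens : exists (C : R) (x0 : nat), forall x, (x0 <= x)%N ->
  `|\sum_(p < x.+1 | prime p) (nb_roots f p)%:R * wt R x p - ln (ln (x%:R : R))| <= C.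
Proof.
have [D [u [v [D0 uvD]]]] := bezout_deriv f_monic size_f f_irr.
have [K [K0 HK]] := count_upper f_monic size_f f_irr D0 uvD.
have [K' [Y0 [K'0 HK']]] := count_lower f_monic size_f f_irr D0 uvD.
pose c2 : R := 2 * K%:R * (1 + (ln 2)^-1).
(* The half absorbs the term [ln (Y0.+2)], at most half of [ln x] for large [x]. *)
pose c1 : R := expR (-1) / K'%:R / 2.
have e1 : 0 < expR (-1) / K'%:R :> R by rewrite divr_gt0 ?expR_gt0 ?ltr0n.
have c1_gt0 : 0 < c1 by rewrite divr_gt0.
have c2_gt0 : 0 < c2.
  rewrite !mulr_gt0 ?ltr0n // addr_gt0 // invr_gt0 ln_gt0 // ltr1n //.
(* [S2] bounds the sum of the squared weights, and [SD] the contribution of the primes dividing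
   [D]. *)
pose S2 : R := n.+1%:R * 2.
pose SD : R := n.+1%:R * `|D|.+1%:R.
have [x1 [x10 Hx1]] := ln_nat_large (1 : R).
have [x2 [x20 Hx2]] := ln_nat_large (2 * ln (Y0.+2%:R : R)).
exists (`|ln c1| + `|ln c2| + S2 + SD), (x1 + x2 + Y0.+1)%N => x xx.
have lnx : 1 <= ln (x%:R : R) by apply: Hx1; lia.
have lnY : 2 * ln (Y0.+2%:R : R) <= ln (x%:R : R) by apply: Hx2; lia.
have l0 : 0 < ln (x%:R : R) by apply: lt_le_trans lnx.
pose P := deg1_primes f D x.
pose Sg := \sum_(a in P) wt R x a.1.
have PiE : \prod_(a in P) (1 + wt R x a.1) = \sum_(A in powerset P) wt R x (set_norm A).
  by rewrite prod_1D_powerset; apply: eq_bigr => A _; rewrite /set_norm wt_prod.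
have nu0 : {in powerset P, forall A, (0 < set_norm A)%N}.
  by move=> A; rewrite powersetE => /set_norm_gt0.
have Pi_up : \prod_(a in P) (1 + wt R x a.1) <= c2 * ln (x%:R : R).
  rewrite PiE; apply: sum_wt_upper => // Y YY; exact: HK.
have Pi_lo : c1 * ln (x%:R : R) <= \prod_(a in P) (1 + wt R x a.1).
  have Y0x : (Y0.+1 <= x)%N by lia.
  rewrite PiE; apply: le_trans (sum_wt_lower lnx nu0 (ltn0Sn Y0) Y0x K'0 _); last first.
    by move=> Y YY Yx; apply: HK' => //; apply: ltnW.
  rewrite /c1 -[X in X <= _]mulrA (ler_pM2l e1); lra.
(* This uses [1 + w <= expR w] factor by factor; the upper bound below uses [expR_le_1D]. *)
have Sg_lo : ln (ln (x%:R : R)) + ln c1 <= Sg.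
  have m1 : 0 < ln (x%:R : R) * c1 by apply: mulr_gt0.
  rewrite -lnM ?posrE // -ler_expR lnK ?posrE // mulrC.
  apply: le_trans Pi_lo _; rewrite expR_sum; apply: ler_prod => a aP.
  by rewrite expR_ge1Dx addr_ge0 // wt_ge0.
have S2_up : \sum_(a in P) wt R x a.1 ^+ 2 <= S2.
  rewrite (sum_deg1_primes D x (fun p => wt R x p ^+ 2)).
  apply: (@le_trans _ _ (\sum_(1 <= p < x.+1) n.+1%:R * p%:R ^- 2)).
    rewrite big_geq_mkord /=.
    apply: (@le_trans _ _ (\sum_(p < x.+1 | prime p && ~~ (val p %| D)%Z) n.+1%:R * p%:R ^- 2)).
      apply: ler_sum => p /andP [prp _]; have p0 := prime_gt0 prp.
      apply: ler_pM; rewrite ?exprn_ge0 ?wt_ge0 ?ler_nat ?(nb_roots_le prp) //.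
      by rewrite -exprVn lerXn2r ?nnegrE ?invr_ge0 ?wt_ge0 // wt_le_inv.
    apply: ler_sum_subset => p; first by move=> /andP [prp _]; apply: prime_gt0.
    by move=> _; rewrite mulr_ge0 // invr_ge0 exprn_ge0.
  rewrite -mulr_sumr ler_wpM2l //.
  rewrite big_ltn; last by lia.
  have := @sum_inv_sq R 1 (x.+1 - 2) isT; rewrite subnKC; last by lia.
  move=> h; have h2 : 0 <= (1 + (x.+1 - 2))%:R^-1 :> R by rewrite invr_ge0.
  rewrite expr1n invr1; rewrite invr1 in h; lra.
have Sg_up : Sg <= ln (ln (x%:R : R)) + ln c2 + S2.
  rewrite -lerBlDr -lnM ?posrE //.
  apply: (@le_trans _ _ (Sg - \sum_(a in P) wt R x a.1 ^+ 2)); first by rewrite lerB.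
  have m2 : 0 < ln (x%:R : R) * c2 by apply: mulr_gt0.
  rewrite -ler_expR lnK ?posrE // mulrC.
  apply: le_trans Pi_up; rewrite /Sg -sumrB expR_sum; apply: ler_prod => a aP.
  by rewrite expR_ge0 expR_le_1D // wt_ge0.
have SDE : 0 <= \sum_(p < x.+1 | prime p) (nb_roots f p)%:R * wt R x p - Sg <= SD.
  rewrite /Sg (sum_deg1_primes D x (fun p => wt R x p)).
  rewrite (bigID (fun p : 'I_x.+1 => (val p %| D)%Z)) /= addrK.
  apply/andP; split.
    by apply: sumr_ge0 => p /andP [prp _]; rewrite mulr_ge0 // wt_ge0.
  apply: (@le_trans _ _ (\sum_(p < x.+1 | prime p && (val p %| D)%Z) n.+1%:R)).
    apply: ler_sum => p /andP [prp _]; rewrite -[X in _ <= X]mulr1.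
    by apply: ler_pM; rewrite ?ler_nat ?(nb_roots_le prp) ?wt_le1 ?wt_ge0 ?prime_gt0.
  rewrite sumr_const -[X in X <= _]mulr_natr ler_wpM2l // ler_nat.
  apply: card_ord_lt => p; rewrite unfold_in => /andP [_]; rewrite dvdzE ltnS => /dvdn_leq; apply.
  by rewrite absz_gt0.
have n1 := ler_norm (ln c2); have n2 := ler_norm (- ln c1); rewrite normrN in n2.
have n3 := normr_ge0 (ln c1); have n4 := normr_ge0 (ln c2).
have S20 : 0 <= S2 by rewrite mulr_ge0.
have SD0 : 0 <= SD by rewrite mulr_ge0.
rewrite ler_norml; move/andP: SDE => [g1 g2]; apply/andP; split; lra.
Qed.

End RootsMertens.

(** * Kummer polynomials *)

Lemma nb_roots_Fp f p : prime p ->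
  nb_roots f p = #|[set z : 'F_p | root (map_poly intr f) z]|.
Proof.
move=> prp; have pF := pchar_Fp prp.
pose h (r : 'I_p) : 'F_p := (val r)%:Z%:~R.
have hI : injective h.
  move=> r s /eqP; rewrite /h (intr_pchar_eq _ _ pF) -eqz_mod_dvd !modz_nat eqz_nat.
  by rewrite !modn_small ?ltn_ord // => /eqP /val_inj.
rewrite /nb_roots -(card_imset _ hI); apply: eq_card => z; apply/imsetP/idP.
  by move=> [r + ->]; rewrite !inE rootE horner_map_intr -(dvdz_pcharf pF).
rewrite inE => rz; have zp : (z < p)%N by rewrite -{2}(Fp_cast prp) ltn_ord.
have E : z = h (Ordinal zp) by rewrite /h /= -pmulrn natr_Zp.
by exists (Ordinal zp) => //; rewrite inE /= (dvdz_pcharf pF) -horner_map_intr -rootE -[(z : nat)%:~R]/(h (Ordinal zp)) -E.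
Qed.

Lemma nb_rootsX p : prime p -> nb_roots 'X p = 1%N.
Proof.
move=> prp; rewrite nb_roots_Fp // map_polyX -(cards1 (0 : 'F_p)).
by apply: eq_card => z; rewrite !inE rootX.
Qed.

Lemma irreducible_X : irreducible_poly (map_poly (intr : int -> rat) 'X).
Proof. by rewrite map_polyX -['X]subr0; apply: irredp_XsubC. Qed.

Section PowerPoly.
Variable q : nat.
Hypothesis prq : prime q.

Definition power_poly (b : int) : {poly int} := 'X^q - b%:P.

Lemma power_poly_monic b : power_poly b \is monic.
Proof. by apply: monicXnsubC; apply: prime_gt0. Qed.

Lemma size_power_poly b : size (power_poly b) = q.-1.+2.
Proof. by rewrite size_XnsubC ?prime_gt0 // prednK // prime_gt0. Qed.

Lemma nb_roots_power p b : prime p ->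
  nb_roots (power_poly b) p = #|[set z : 'F_p | z ^+ q == b%:~R]|.
Proof.
move=> prp; rewrite nb_roots_Fp //; apply: eq_card => z; rewrite !inE rootE.
by rewrite rmorphB /= map_polyXn map_polyC /= !hornerE subr_eq0.
Qed.

Lemma rat_power_int (a : rat) (b : int) : a ^+ q = b%:~R -> exists m : int, m ^+ q = b.
Proof.
move=> aE; have q0 := prime_gt0 prq.
have d0 : (denq a)%:~R != 0 :> rat by rewrite intr_eq0 denq_neq0.
have E : numq a ^+ q = b * denq a ^+ q.
  apply: (@intr_inj rat); rewrite rmorphXn rmorphM rmorphXn /= -aE -[X in X ^+ q * _](divq_num_den a).
  by rewrite exprMn exprVn mulfVK ?expf_neq0.
have : coprimez (denq a) (numq a ^+ q).
  by rewrite coprimezXr // /coprimez /gcdz gcdnC -/(gcdz (numq a) (denq a)) -/(coprimez _ _) coprimezE coprime_num_den.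
have dd : (denq a %| numq a ^+ q)%Z.
  by rewrite E; apply: dvdz_mull; rewrite -(prednK q0) exprS dvdz_mulr.
rewrite coprimezE /coprime; move/gcdn_idPl: dd => -> /eqP d1.
exists (numq a); rewrite E; have := denq_gt0 a; move: (denq a) d1 => d d1 dp.
have -> : d = 1 by lia.
by rewrite expr1n mulr1.
Qed.

(** With [u * k = v * q + 1], the number [b] is the [q]th power of [a ^ u / b ^ v]. *)
Lemma rat_power_coprime (a : rat) (b : int) k : (0 < k < q)%N ->
  a ^+ q = (b ^+ k)%:~R -> exists m : int, m ^+ q = b.
Proof.
move=> /andP [k0 kq] yE; have q0 := prime_gt0 prq.
have [->|b0] := eqVneq b 0; first by exists 0; rewrite expr0n gtn_eqF.
have cop : coprime k q by rewrite coprime_sym prime_coprime // gtnNdvd.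
have [u v uk _] := egcdnP q k0; rewrite (eqP cop) in uk.
have b0' : b%:~R != 0 :> rat by rewrite intr_eq0.
apply: (@rat_power_int (a ^+ u / b%:~R ^+ v)).
rewrite exprMn exprVn -!exprM mulnC exprM yE -rmorphXn /= -exprM mulnC uk addn1 exprS.
by rewrite rmorphM rmorphXn /= mulfK ?expf_neq0.
Qed.

(** A proper factor over the rationals is, up to a scalar, a product over [j] of the complex roots
    with [0 < j < q]. The product of these roots is rational and has [q]th power [b ^ j], which
    makes [b] itself a [q]th power. *)
Lemma irreducible_power (b : int) : (forall m : int, m ^+ q <> b) ->
  irreducible_poly (map_poly (intr : int -> rat) (power_poly b)).
Proof.
move=> nb; have q0 := prime_gt0 prq.
set F := map_poly _ _.
have FE : F = 'X^q - (b%:~R)%:P by rewrite /F rmorphB /= map_polyXn map_polyC.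
have sF : size F = q.+1 by rewrite FE size_XnsubC.
split; first by rewrite sF ltnS.
move=> g sg gF; rewrite -dvdp_size_eqp // sF.
have F0 : F != 0 by rewrite -size_poly_gt0 sF.
have g0 : g != 0 by apply: contraTneq gF => ->; rewrite dvd0p.
apply/negPn/negP => ng.
pose gC := map_poly (ratr : rat -> algC) g; pose FC := map_poly (ratr : rat -> algC) F.
have gFC : gC %| FC by rewrite dvdp_map.
have FCE : FC = 'X^q - (b%:~R)%:P.
  by rewrite /FC FE rmorphB /= map_polyXn map_polyC /= ratr_int.
have [rs rsE] := closed_field_poly_normal FC.
have FCm : lead_coef FC = 1 by rewrite FCE lead_coefXnsubC.
rewrite FCm scale1r in rsE.
have zq z : z \in rs -> z ^+ q = b%:~R.
  move=> zrs; have : root FC z by rewrite rsE root_prod_XsubC.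
  by rewrite FCE rootE !hornerE subr_eq0 => /eqP.
move: gFC; rewrite rsE => /dvdp_prod_XsubC [m gE].
set s := mask m rs in gE.
have ss : size s = (size g).-1.
  by have := eqp_size gE; rewrite size_prod_XsubC size_map_poly => ->.
have sk : (0 < size s < q)%N.
  have := dvdp_leq F0 gF; rewrite sF; have := size_poly_gt0 g; rewrite g0.
  by move: ng sg; rewrite ss; lia.
have yQ : \prod_(z <- s) z \in Crat.
  have prodN (t : seq algC) : \prod_(z <- t) z = (-1) ^+ size t * \prod_(z <- t) - z.
    elim: t => [|z t IH]; first by rewrite !big_nil mulr1.
    by rewrite !big_cons /= IH exprS mulrACA mulN1r opprK.
  have lc0 : lead_coef gC != 0 by rewrite lead_coef_eq0 map_poly_eq0.
  have gE' : gC = lead_coef gC *: \prod_(z <- s) ('X - z%:P).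
    have /eqpf_eq [c c0 gE'] := gE; rewrite {2}gE' lead_coefZ.
    by rewrite (monicP (monic_prod_XsubC _ _ _)) mulr1.
  have h0 : gC`_0 = lead_coef gC * \prod_(z <- s) - z.
    rewrite -horner_coef0 {1}gE' hornerZ horner_prod; congr (_ * _).
    by apply: eq_bigr => z _; rewrite hornerXsubC sub0r.
  rewrite prodN -[X in _ * X](mulKf lc0) -h0 rpredM ?rpredX ?rpredN ?rpred1 //.
  by rewrite rpredM ?rpredV // ?lead_coef_map ?coef_map; apply: Crat_rat.
have yE : (\prod_(z <- s) z) ^+ q = (b ^+ size s)%:~R.
  rewrite -prodrXl big_seq (eq_bigr (fun=> b%:~R)); last by move=> z /mem_mask /zq.
  by rewrite -big_seq big_const_seq iter_mulr_1 count_predT rmorphXn.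
have /CratP [a aE] := yQ.
have aq : a ^+ q = (b ^+ size s)%:~R.
  by apply: (fmorph_inj (ratr : {rmorphism rat -> algC})); rewrite rmorphXn /= -aE yE ratr_int.
by have [m' /nb] := rat_power_coprime sk aq.
Qed.

(** The [q]th cyclotomic polynomial at [X + 1], the form to which Eisenstein's criterion applies. *)
Definition shifted_cyclotomic : {poly int} := \poly_(i < q) 'C(q, i.+1)%:Z.

Lemma shifted_cyclotomicE : shifted_cyclotomic * 'X = ('X + 1) ^+ q - 1.
Proof.
rewrite exprD1n big_ord_recl /= expr0 bin0 mulr1n addrC addKr /shifted_cyclotomic poly_def mulr_suml.
apply: eq_bigr => i _; rewrite -scalerAl -exprSr -[_%:Z]natz scaler_nat.
by rewrite /bump /= add1n.
Qed.

Lemma size_shifted_cyclotomic : size shifted_cyclotomic = q.-2.+2.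
Proof.
have q1 := prime_gt1 prq.
have -> : q.-2.+2 = q by lia.
rewrite size_poly_eq // prednK ?binn //; lia.
Qed.

Lemma shifted_cyclotomic_monic : shifted_cyclotomic \is monic.
Proof.
rewrite monicE lead_coefE size_shifted_cyclotomic /= coef_poly.
have q1 := prime_gt1 prq; have -> : q.-2.+2 = q by lia.
by rewrite leqnn binn.
Qed.

Lemma irreducible_shifted_cyclotomic :
  irreducible_poly (map_poly (intr : int -> rat) shifted_cyclotomic).
Proof.
have q1 := prime_gt1 prq.
apply/irreducible_rat_int; apply: (eisenstein_crit prq).
- by rewrite size_shifted_cyclotomic.
- by rewrite (monicP shifted_cyclotomic_monic) dvdzE /= dvdn1 gtn_eqF.
- rewrite coef_poly (ltnW q1) bin1 natrXE dvdzE /= -mulnn; apply/negP => /(dvdn_leq (prime_gt0 prq)); nia.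
- move=> i; rewrite size_shifted_cyclotomic /= => iq; rewrite coef_poly.
  case: ifP => // _; rewrite dvdzE /=; apply: prime_dvd_bin => //; lia.
Qed.

(** The roots of unity other than 1 are the shifts by 1 of the roots of the cyclotomic factor. The
    value 1 itself is not hit, because the constant coefficient [q] is nonzero modulo [p]. *)
Lemma nb_roots_shifted_cyclotomic p : prime p -> p != q ->
  nb_roots (power_poly 1) p = (nb_roots shifted_cyclotomic p).+1.
Proof.
move=> prp pq; have pF := pchar_Fp prp.
rewrite nb_roots_power // nb_roots_Fp //.
set g := map_poly _ _.
have gE z : g.[z] * z = (z + 1) ^+ q - 1.
  have := congr1 (map_poly (intr : int -> 'F_p)) shifted_cyclotomicE.
  rewrite rmorphM rmorphB rmorphXn rmorphD /= map_polyX rmorph1.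
  by move=> /(congr1 (fun h => h.[z])); rewrite !hornerE.
have g0 : ~~ root g 0.
  rewrite rootE horner_coef0 coef_map_intr coef_poly prime_gt0 // bin1.
  by rewrite -(dvdz_pcharf pF) dvdzE /= dvdn_prime2.
have -> : [set z : 'F_p | z ^+ q == 1%:~R] = 1 |: [set z + 1 | z in [set z | root g z]].
  apply/setP => y; rewrite !inE; apply/idP/orP => [/eqP yq|[/eqP ->|/imsetP [z]]].
  - have [->|y1] := eqVneq y 1; [by left|right]; apply/imsetP; exists (y - 1); last by rewrite subrK.
    rewrite inE rootE; have := gE (y - 1); rewrite subrK yq subrr => /eqP.
    by rewrite mulf_eq0 subr_eq0 (negPf y1) orbF.
  - by rewrite expr1n.
  - rewrite inE => /rootP gz ->; have := gE z; rewrite gz mul0r => /esym/eqP.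
    by rewrite subr_eq0.
rewrite cardsU1 card_imset; last exact: addIr.
suff -> : (1 : 'F_p) \notin [set z + 1 | z in [set z | root g z]] by rewrite add1n.
apply/imsetP => -[z]; rewrite inE => rz /eqP; rewrite eq_sym -subr_eq0 addrK => /eqP z0.
by move: rz; rewrite z0 (negPf g0).
Qed.

End PowerPoly.

From mathcomp Require Import classical_sets topology normedtype.
From mathcomp Require Import Rstruct Rstruct_topology.
Import numFieldNormedType.Exports.

(** * Sets containing a power modulo almost every prime are dependent *)

Lemma card_power_eq_shift (F : finFieldType) q (B y : F) : y != 0 ->
  #|[set z : F | z ^+ q == B * y ^+ q]| = #|[set z : F | z ^+ q == B]|.
Proof.
move=> y0; rewrite -(card_imset (mem [set z : F | z ^+ q == B]) (mulIf y0)).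
apply: eq_card => z; rewrite inE; apply/idP/imsetP => [/eqP zq|[w + ->]].
  exists (z / y); last by rewrite mulfVK.
  by rewrite inE expr_div_n zq mulfK ?expf_neq0.
by rewrite inE exprMn => /eqP ->.
Qed.

Lemma abel_bound (R : realFieldType) (d w : nat -> R) (B : R) x :
  (forall N, 0 <= w N) -> (forall N, w N.+1 <= w N) ->
  (forall N, \sum_(i < N) d i <= B) ->
  \sum_(i < x) d i * w i <= B * w 0%N.
Proof.
move=> w0 wd dB.
have B0 : 0 <= B by have := dB 0%N; rewrite big_ord0.
suff H N : \sum_(i < N.+1) d i * w i <= B * (w 0%N - w N) + (\sum_(i < N.+1) d i) * w N.
  case: x => [|N]; first by rewrite big_ord0 mulr_ge0.
  apply: le_trans (H N) _; have := ler_wpM2r (w0 N) (dB N.+1); lra.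
elim: N => [|N IH]; first by rewrite !big_ord_recl !big_ord0 subrr mulr0 !addr0 add0r.
rewrite big_ord_recr /= [X in _ <= _ + X * _]big_ord_recr /=.
apply: le_trans (lerD IH (lexx _)) _.
have h : 0 <= w N - w N.+1 by rewrite subr_ge0.
have := ler_wpM2r h (dB N.+1).
move: (\sum_(i < N.+1) d i) => s; lra.
Qed.

Section Kummer.
Variables (R : realType) (q k : nat) (a : 'I_k -> int).
Hypothesis prq : prime q.
Local Notation E := {ffun 'I_k -> 'F_q}.

Definition kummer_prod (e : E) : int := \prod_i a i ^+ (e i : nat).

(** The sum of the nontrivial additive characters of ['F_q] at [\sum_i e i]. *)
Definition kappa (e : E) : R := q%:R * (\sum_i e i == 0)%:R - 1.

Definition kummer_sum (p : nat) : R :=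
  \sum_(e : E) kappa e * ((nb_roots (power_poly q (kummer_prod e)) p)%:R - 1).

(* Replacing [e i] by [e i + t] changes no root count when [a i] is a [q]th power
   modulo [p], while [kappa] averages to zero over [t]. *)
Lemma kummer_sum_eq0 p i : prime p -> ~~ (p %| a i)%Z -> qth_power_mod q p (a i) ->
  kummer_sum p = 0.
Proof.
move=> prp pai [y0 yE]; have pF := pchar_Fp prp; have q0 := prime_gt0 prq.
pose y : 'F_p := y0%:~R.
have ay : (a i)%:~R = y ^+ q.
  apply/eqP; rewrite -subr_eq0 -rmorphXn -rmorphB /= -(dvdz_pcharf pF).
  by rewrite -eqz_mod_dvd.
have yn0 : y != 0.
  by apply: contra pai => /eqP y0'; rewrite (dvdz_pcharf pF) ay y0' expr0n gtn_eqF.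
pose sh (t : 'F_q) (e : E) : E := [ffun j => if j == i then e j + t else e j].
have sh_inj t : injective (sh t).
  move=> e e' /ffunP H; apply/ffunP => j; have := H j; rewrite !ffunE.
  by case: ifP => // _ /addIr.
pose B (e : E) : 'F_p := \prod_(j | j != i) (a j)%:~R ^+ (e j : nat).
have FE e : nb_roots (power_poly q (kummer_prod e)) p = #|[set z : 'F_p | z ^+ q == B e]|.
  rewrite nb_roots_power // -(@card_power_eq_shift _ q (B e) (y ^+ (e i : nat))) ?expf_neq0 //.
  apply: eq_card => z; rewrite !inE; congr (_ == _).
  rewrite rmorph_prod (bigD1 i) //= rmorphXn /= ay -!exprM [(q * _)%N]mulnC mulrC; congr (_ * _).
  by apply: eq_bigr => j _; rewrite rmorphXn.
have Fsh t e : B (sh t e) = B e.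
  by apply: eq_bigr => j /negPf ji; rewrite ffunE ji.
have GE t : kummer_sum p = \sum_(e : E) kappa (sh t e) * ((nb_roots (power_poly q (kummer_prod e)) p)%:R - 1).
  rewrite /kummer_sum (reindex_inj (sh_inj t)) /=; apply: eq_bigr => e _.
  by rewrite !FE Fsh.
have : \sum_(t : 'F_q) kummer_sum p = 0.
  under eq_bigr => t _ do rewrite (GE t).
  rewrite exchange_big /= big1 // => e _; rewrite -mulr_suml.
  suff -> : \sum_(t : 'F_q) kappa (sh t e) = 0 by rewrite mul0r.
  have sE t : \sum_j sh t e j = \sum_j e j + t.
    rewrite (bigD1 i) //= ffunE eqxx [in RHS](bigD1 i) //= addrAC; congr (_ + _ + _).
    by apply: eq_bigr => j /negPf ji; rewrite ffunE ji.
  rewrite /kappa sumrB -mulr_sumr sumr_const card_Fp // (bigD1 (- \sum_j e j)) //=.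
  rewrite sE subrr eqxx big1 ?addr0 ?mulr1 ?subrr // => t nt.
  by rewrite sE addrC addr_eq0 (negPf nt).
rewrite sumr_const card_Fp // => /eqP; rewrite mulrn_eq0 gtn_eqF //=.
by move/eqP.
Qed.

Lemma kappa_norm e : `|kappa e| <= q%:R.
Proof.
rewrite /kappa; have q1 : 1 <= q%:R :> R by rewrite ler1n prime_gt0.
by rewrite ler_norml; case: (_ == _); rewrite ?mulr1 ?mulr0; apply/andP; split; lra.
Qed.

Lemma kummer_sum_bound p : prime p -> `|kummer_sum p| <= (#|{: E}| * (q * q.+1))%:R.
Proof.
move=> prp; apply: le_trans (ler_norm_sum _ _ _) _.
apply: (@le_trans _ _ (\sum_(e : E) (q * q.+1)%:R)); last first.
  by rewrite sumr_const -[X in X <= _]mulr_natl -natrM.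
apply: ler_sum => e _; rewrite normrM natrM; apply: ler_pM => //; first exact: kappa_norm.
have h := nb_roots_le prp (power_poly_monic prq (kummer_prod e)) (size_power_poly prq _).
rewrite prednK ?prime_gt0 // in h.
apply: le_trans (ler_normB _ _) _; rewrite normr1 ger0_norm // natr1 ler_nat //.
Qed.

Hypothesis indep : forall e : E, e != 0 -> forall m : int, m ^+ q <> kummer_prod e.

(** For [e != 0] the Kummer polynomial is irreducible, so its root count averages to 1 like that of
    ['X] and the term stays bounded. For [e = 0] the polynomial ['X^q - 1] has the cyclotomic roots
    in excess, which gives [ln (ln x)] times [kappa 0 = q - 1 >= 1]. *)
Lemma kummer_sum_mertens : exists (C : R) (x0 : nat), forall x, (x0 <= x)%N ->
  ln (ln (x%:R : R)) - C <= \sum_(p < x.+1 | prime p) kummer_sum p * wt R x p.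
Proof.
have q0 := prime_gt0 prq; have q1 := prime_gt1 prq.
have [CX [xX HX]] := roots_mertens R (monicX _) (size_polyX _) irreducible_X.
have [CC [xC HC]] := roots_mertens R (shifted_cyclotomic_monic prq)
  (size_shifted_cyclotomic prq) (irreducible_shifted_cyclotomic prq).
have He (e : E) : exists Cx : R * nat, e != 0 -> forall x, (Cx.2 <= x)%N ->
  `|\sum_(p < x.+1 | prime p) (nb_roots (power_poly q (kummer_prod e)) p)%:R * wt R x p
     - ln (ln (x%:R : R))| <= Cx.1.
  have [->|e0] := eqVneq e 0; first by exists (0, 0%N).
  have [C [x0 H]] := roots_mertens R (power_poly_monic prq (kummer_prod e))
    (size_power_poly prq _) (irreducible_power prq (indep e0)).
  by exists (C, x0).
have [Ce HCe] := choice He.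
have [x1 [_ Hx1]] := ln_nat_large (1 : R).
have [x2 [_ Hx2]] := ln_nat_large (expR (CC + q.+1%:R) : R).
pose C1 := \sum_(e : E) q%:R * (`|(Ce e).1| + `|CX|).
exists (q%:R * (`|CC| + q.+1%:R) + C1), (x1 + x2 + xX + xC + \sum_(e : E) (Ce e).2)%N => x xx.
have lnx : 1 <= ln (x%:R : R) by apply: Hx1; lia.
have sX : `|\sum_(p < x.+1 | prime p) wt R x p - ln (ln (x%:R : R))| <= CX.
  have := HX x ltac:(lia).
  suff -> : \sum_(p < x.+1 | prime p) (nb_roots 'X p)%:R * wt R x p =
            \sum_(p < x.+1 | prime p) wt R x p by [].
  by apply: eq_bigr => p prp; rewrite nb_rootsX // mul1r.
pose T (e : E) : R := \sum_(p < x.+1 | prime p)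
  ((nb_roots (power_poly q (kummer_prod e)) p)%:R - 1) * wt R x p.
have -> : \sum_(p < x.+1 | prime p) kummer_sum p * wt R x p = \sum_(e : E) kappa e * T e.
  under eq_bigr => p _ do rewrite /kummer_sum mulr_suml.
  rewrite exchange_big /=; apply: eq_bigr => e _; rewrite mulr_sumr.
  by apply: eq_bigr => p _; rewrite mulrA.
have Te e : e != 0 -> - (q%:R * (`|(Ce e).1| + `|CX|)) <= kappa e * T e.
  move=> e0; have ex : ((Ce e).2 <= x)%N.
    apply: leq_trans xx; rewrite (bigD1 e) //=; lia.
  have := HCe e e0 x ex => h.
  have : `|kappa e * T e| <= q%:R * (`|(Ce e).1| + `|CX|).
    rewrite normrM; apply: ler_pM => //; first exact: kappa_norm.
    have -> : T e = (\sum_(p < x.+1 | prime p)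
        (nb_roots (power_poly q (kummer_prod e)) p)%:R * wt R x p - ln (ln (x%:R : R)))
        - (\sum_(p < x.+1 | prime p) wt R x p - ln (ln (x%:R : R))).
      rewrite opprB addrA subrK -sumrB; apply: eq_bigr => p _.
      by rewrite mulrBl mul1r.
    apply: le_trans (ler_normB _ _) _; apply: lerD.
      exact: le_trans h (ler_norm _).
    exact: le_trans sX (ler_norm _).
  by rewrite ler_norml => /andP [].
have T0 : ln (ln (x%:R : R)) - CC - q.+1%:R <= T 0.
  have := HC x ltac:(lia); rewrite ler_norml => /andP [h _].
  have b0 : kummer_prod 0 = 1.
    by rewrite /kummer_prod big1 // => i _; rewrite ffunE expr0.
  (* Only [p = q] breaks the relation between the two root counts, at a cost of at most [q.+1]. *)
  have : \sum_(p < x.+1 | prime p) (nb_roots (shifted_cyclotomic q) p)%:R * wt R x p - q.+1%:R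
     <= T 0.
    rewrite lerBlDr -lerBlDl -sumrB.
    apply: (@le_trans _ _ (\sum_(p < x.+1 | prime p && (p == q :> nat)) q.+1%:R)).
      rewrite [X in _ <= X]big_mkcondr /=; apply: ler_sum => p prp; rewrite b0 -mulrBl.
      case: ifP => [pq|/negbT pq]; last first.
        by rewrite nb_roots_shifted_cyclotomic // -natr1 addrK subrr mul0r.
      have n1 := nb_roots_le prp (shifted_cyclotomic_monic prq) (size_shifted_cyclotomic prq).
      have n2 : (nb_roots (shifted_cyclotomic q) p)%:R <= q%:R :> R by rewrite ler_nat; lia.
      have n3 : 0 <= (nb_roots (power_poly q 1) p)%:R :> R by [].
      apply: (@le_trans _ _ (q.+1%:R * wt R x p)).
        by rewrite ler_wpM2r ?wt_ge0 // -natr1; lra.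
      by rewrite ler_piMr // wt_le1 // prime_gt0.
    rewrite sumr_const -[X in X <= _]mulr_natl ler_piMl //.
    rewrite -[X in _ <= X]/(1%N%:R) ler_nat -(card1 (inord q : 'I_x.+1)).
    apply/subset_leq_card/fintype.subsetP => p; rewrite unfold_in => /andP [_ /eqP pq].
    by rewrite inE -pq inord_val.
  lra.
rewrite (bigD1 (0 : E)) //=.
have h1 : - C1 <= \sum_(e : E | e != 0) kappa e * T e.
  apply: (@le_trans _ _ (\sum_(e : E | e != 0) - (q%:R * (`|(Ce e).1| + `|CX|)))).
    rewrite sumrN lerN2; apply: ler_sum_subset => // e _.
    by rewrite mulr_ge0 // addr_ge0.
  by apply: ler_sum => e; apply: Te.
have k0 : kappa 0 = q%:R - 1.
  by rewrite /kappa big1 ?eqxx ?mulr1 // => i _; rewrite ffunE.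
have q2 : 2 <= q%:R :> R by rewrite ler_nat.
(* For such [x] the main term [T 0] is nonnegative, so the factor [kappa 0 >= 1] can only increase
   it. *)
have L0 : CC + q.+1%:R <= ln (ln (x%:R : R)).
  rewrite -[X in X <= _]expRK ler_ln ?posrE ?expR_gt0 //; first by apply: Hx2; lia.
  exact: lt_le_trans lnx.
have T00 : 0 <= T 0 by apply: le_trans T0; lra.
have kT : T 0 <= kappa 0 * T 0 by rewrite ler_peMl // k0; lra.
have cc := ler_norm CC.
have h2 : CC + q.+1%:R <= q%:R * (`|CC| + q.+1%:R).
  apply: (@le_trans _ _ (1 * (`|CC| + q.+1%:R))); first by rewrite mul1r lerD2r.
  by apply: ler_wpM2r; [rewrite addr_ge0 | lra].
lra.
Qed.

End Kummer.

Lemma sum_prime_shift (R : realType) x (F : nat -> R) :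
  \sum_(p < x.+1 | prime p) F p = \sum_(i < x) (prime i.+1)%:R * F i.+1.
Proof.
rewrite big_mkcond big_ord_recl /= add0r; apply: eq_bigr => i _.
by rewrite /bump /= add1n; case: (prime _); rewrite ?mul1r ?mul0r.
Qed.

Lemma prime_countE (R : realType) (P : nat -> Prop) N :
  (prime_count P N)%:R = \sum_(i < N) (prime i.+1 && `[< P i.+1 >])%:R :> R.
Proof.
rewrite /prime_count -sum1_card natr_sum.
rewrite (eq_bigl (fun p : 'I_N.+1 => prime p && `[< P p >])); last by move=> p; rewrite inE.
rewrite big_mkcond big_ord_recl /= add0r; apply: eq_bigr => i _.
by rewrite /bump /= add1n; case: (_ && _).
Qed.

(** Beyond [N0] the exceptional primes up to [N] number at most [eps] times all primes up to [N].
    The partial sums of the difference are thus at most [N0], and Abel summation against the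
    decreasing weights concludes. *)
Lemma wt_sum_null_density (R : realType) (P : nat -> Prop) (eps : R) : 0 < eps ->
  ((fun N : nat => (prime_count P N)%:R / (prime_count (fun _ => True) N)%:R : R)
    @ \oo --> (1 : R))%classic ->
  exists B : R, forall x, 1 <= ln (x%:R : R) ->
   \sum_(p < x.+1 | prime p) (~~ `[< P p >])%:R * wt R x p <=
     B + eps * \sum_(p < x.+1 | prime p) wt R x p.
Proof.
move=> e0 /cvgrPdist_lt /(_ eps e0) [N0 _ HN].
exists N0%:R => x lnx.
rewrite (sum_prime_shift x (fun p => (~~ `[< P p >])%:R * wt R x p)).
rewrite (sum_prime_shift x (fun p => wt R x p)) -lerBlDr mulr_sumr -sumrB.
pose d i : R := (prime i.+1 && ~~ `[< P i.+1 >])%:R - eps * (prime i.+1)%:R.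
rewrite (eq_bigr (fun i : 'I_x => d i * wt R x i.+1)); last first.
  by move=> i _; rewrite /d mulrBl; case: (prime _); rewrite /= !(mul1r, mulr1, mul0r, mulr0).
have -> : N0%:R = N0%:R * wt R x 1 :> R by rewrite wt1 mulr1.
apply: (abel_bound (w := fun i => wt R x i.+1)) => [N|N|N]; first exact: wt_ge0.
  exact: wt_le.
rewrite /d sumrB.
have [NN|NN] := leqP N0 N; last first.
  apply: (@le_trans _ _ (\sum_(i < N) 1)).
    rewrite -sumrB; apply: ler_sum => i _.
    apply: (@le_trans _ _ (prime i.+1 && ~~ `[< P i.+1 >])%:R); last by case: (_ && _).
    by rewrite lerBlDr lerDl mulr_ge0 // ltW.
  by rewrite sumr_const card_ord ler_nat ltnW.
apply: (@le_trans _ _ 0) => //.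
have := HN N NN; rewrite /= !prime_countE.
set pc := \sum_(i < N) _; set qc := \sum_(i < N) _.
have -> : \sum_(i < N) (prime i.+1 && ~~ `[< P i.+1 >])%:R = qc - pc.
  rewrite -sumrB; apply: eq_bigr => i _.
  by rewrite (asboolT I) andbT; case: (prime _); case: (`[< P _ >]); rewrite /= ?subr0 ?subrr.
have -> : \sum_(i < N) eps * (prime i.+1)%:R = eps * qc.
  by rewrite mulr_sumr; apply: eq_bigr => i _; rewrite (asboolT I) andbT.
have qc0 : 0 <= qc by apply: sumr_ge0.
have [->|qn] := eqVneq qc 0.
  have : 0 <= pc by apply: sumr_ge0.
  by lra.
have qp : 0 < qc by rewrite lt_neqAle eq_sym qn.
move=> h; have : 1 - pc / qc < eps by apply: le_lt_trans (ler_norm _) h.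
rewrite -(ltr_pM2r qp) mulrBl mulfVK // mul1r; lra.
Qed.

(** The average of [kummer_sum] grows at least like [ln (ln x)]. Apart from the finitely many primes
    dividing some [a i], it is supported on primes where [A] contains no [q]th power; if these had
    density zero, their contribution would be at most half of [ln (ln x)] plus a constant. *)
Theorem independent_not_ae q k (a : 'I_k -> int) (A : {fset int}) : prime q ->
  (forall e : {ffun 'I_k -> 'F_q}, e != 0 -> forall m : int, m ^+ q <> kummer_prod a e) ->
  (forall z, z \in A -> exists i, z = a i) -> ~ qth_power_ae q A.
Proof.
move=> prq indep HA; rewrite /qth_power_ae /rel_density.
suff H (R : realType) : ~ ((fun N : nat => (prime_count (contains_qth_power_mod q A) N)%:R
   / (prime_count (fun _ => True) N)%:R : R) @ \oo --> (1 : R))%classic by exact: H.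
set P := contains_qth_power_mod q A => dens.
have [C [x0 HC]] := kummer_sum_mertens R prq indep.
have [CX [xX HX]] := roots_mertens R (monicX _) (size_polyX _) irreducible_X.
pose M : R := (#|{: {ffun 'I_k -> 'F_q}}| * (q * q.+1))%:R + 1.
have M0 : 0 < M by rewrite ltr_wpDl.
(* [M] bounds [kummer_sum], so this density threshold produces the factor one half. *)
have e0 : 0 < (2 * M)^-1 by rewrite invr_gt0 mulr_gt0.
have [B HB] := wt_sum_null_density e0 dens.
(* Otherwise the exponent vector supported at [i] would give the product 0, a [q]th power. *)
have a0 i : a i != 0.
  apply/eqP => ai; pose e : {ffun 'I_k -> 'F_q} := [ffun j => (j == i)%:R].
  have : e != 0.
    by apply/eqP => /ffunP /(_ i); rewrite !ffunE eqxx => /eqP; rewrite oner_eq0.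
  move/indep => /(_ 0); apply; rewrite expr0n gtn_eqF ?prime_gt0 //.
  have ei : (e i : nat) != 0%N.
    by rewrite ffunE eqxx; apply/eqP => /(congr1 (fun j : nat => (j%:R : 'F_q))); rewrite natr_Zp => /eqP; rewrite oner_eq0.
  by rewrite /kummer_prod (bigD1 i) //= ai expr0n (negPf ei) mul0r.
pose Pi := (\prod_i `|a i|)%N.
have Pi0 : (0 < Pi)%N by rewrite prodn_gt0 // => i; rewrite absz_gt0.
have ks p : prime p -> kummer_sum R q a p <= M * (~~ `[< P p >])%:R + M * (p %| Pi)%N%:R.
  move=> prp.
  have kM : kummer_sum R q a p <= M.
    apply: le_trans (ler_norm _) _; apply: le_trans (kummer_sum_bound R a prq prp) _.
    by rewrite /M lerDl.
  have [pPi|pPi] := boolP (p %| Pi)%N.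
    rewrite mulr1; apply: le_trans kM _; rewrite lerDr mulr_ge0 //; exact: ltW.
  rewrite mulr0 addr0; case: (boolP `[< P p >]) => [/asboolP [z zA zq]|_]; last by rewrite mulr1.
  have [i zi] := HA z zA; rewrite mulr0 (@kummer_sum_eq0 R q k a prq p i) //; last by rewrite -zi.
  apply: contra pPi => pai; rewrite /Pi (bigD1 i) //= dvdn_mulr //.
pose cst := C + M * B + `|CX| + M * Pi.+1%:R.
have [x1 [_ Hx1]] := ln_nat_large (1 : R).
have [x2 [_ Hx2]] := ln_nat_large (expR (2 * cst + 1)).
pose x := (x0 + xX + x1 + x2)%N.
have lnx : 1 <= ln (x%:R : R) by apply: Hx1; rewrite /x; lia.
have L0 : 2 * cst + 1 <= ln (ln (x%:R : R)).
  rewrite -[X in X <= _]expRK ler_ln ?posrE ?expR_gt0 //; first by apply: Hx2; rewrite /x; lia.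
  exact: lt_le_trans lnx.
have sX : \sum_(p < x.+1 | prime p) wt R x p <= ln (ln (x%:R : R)) + `|CX|.
  have xx : (xX <= x)%N by rewrite /x; lia.
  have := HX x xx; rewrite (eq_bigr (fun p : 'I_x.+1 => wt R x p)); last first.
    by move=> p prp; rewrite nb_rootsX // mul1r.
  have := ler_norm CX; rewrite ler_norml => h /andP [_ h2]; lra.
have x0x : (x0 <= x)%N by rewrite /x; lia.
have lo := HC x x0x.
have up : \sum_(p < x.+1 | prime p) kummer_sum R q a p * wt R x p <=
   M * \sum_(p < x.+1 | prime p) (~~ `[< P p >])%:R * wt R x p + M * Pi.+1%:R.
  apply: (@le_trans _ _ (\sum_(p < x.+1 | prime p)
     (M * ((~~ `[< P p >])%:R * wt R x p) + M * (p %| Pi)%N%:R))).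
    apply: ler_sum => p prp; apply: le_trans (ler_wpM2r (wt_ge0 R x p) (ks p prp)) _.
    rewrite mulrDl mulrA lerD2l ler_piMr ?wt_le1 ?prime_gt0 //.
    by rewrite mulr_ge0 // ltW.
  rewrite big_split /= -!mulr_sumr lerD2l; apply: ler_wpM2l; first exact: ltW.
  rewrite -natr_sum ler_nat -big_mkcondr /= sum1_card.
  apply: card_ord_lt => p; rewrite unfold_in => /andP [_ pp].
  by rewrite ltnS dvdn_leq.
have hB := HB x lnx.
have : M * \sum_(p < x.+1 | prime p) (~~ `[< P p >])%:R * wt R x p <=
   M * B + 2^-1 * (ln (ln (x%:R : R)) + `|CX|).
  apply: le_trans (ler_wpM2l (ltW M0) hB) _; rewrite mulrDr lerD2l mulrA.
  have -> : M * (2 * M)^-1 = 2^-1 by rewrite invfM mulrCA mulfV ?mulr1 ?gt_eqF.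
  by rewrite ler_wpM2l // invr_ge0.
have := normr_ge0 CX; move: L0 lo up; rewrite /cst; lra.
Qed.

(** * Counting dependent sets *)

Section DependentSets.
Local Open Scope fset_scope.

Lemma card_fiber_bound (X : finType) k (i : 'I_k) (W : {set {ffun 'I_k -> X}}) L :
  {in W, forall t : {ffun 'I_k -> X}, (#|[set t' i | t' : {ffun 'I_k -> X} in W & [forall j, (j != i) ==> (t' j == t j)]]| <= L)%N} ->
  (#|W| <= L * #|X| ^ k.-1)%N.
Proof.
move=> HL.
pose restr (t : {ffun 'I_k -> X}) : {ffun {j : 'I_k | j != i} -> X} := [ffun j => t (val j)].
have restrP t t' : restr t' = restr t -> [forall j, (j != i) ==> (t' j == t j)].
  move=> /ffunP E; apply/forallP => j; apply/implyP => ji.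
  by have := E (exist _ j ji); rewrite !ffunE /= => ->.
have -> : (#|X| ^ k.-1)%N = #|[set: {ffun {j : 'I_k | j != i} -> X}]|.
  by rewrite cardsT card_ffun card_sig cardC1 card_ord.
apply: (card_union_bound (R := fun g => [set t in W | restr t == g])) => [t tW|g _].
  by exists (restr t); rewrite // inE tW eqxx.
have [->|[t0]] := finset.set_0Vmem [set t in W | restr t == g]; first by rewrite cards0.
rewrite inE => /andP [t0W /eqP t0g]; apply: leq_trans (HL t0 t0W).
rewrite -(card_in_imset (f := fun t : {ffun 'I_k -> X} => t i)).
  apply/subset_leq_card/fintype.subsetP => _ /imsetP [t + ->]; rewrite inE => /andP [tW /eqP tg].
  apply/imsetP; exists t => //; rewrite inE tW; apply: restrP; by rewrite tg.
move=> t t'; rewrite !inE => /andP [_ /eqP tg] /andP [_ /eqP tg'] ti.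
apply/ffunP => j; have [->|ji] := eqVneq j i; first exact: ti.
have /restrP /forallP /(_ j) : restr t = restr t' by rewrite tg tg'.
by rewrite ji => /eqP.
Qed.

Lemma logn_prodn p (I : finType) (P : pred I) (F : I -> nat) :
  (forall i, P i -> (0 < F i)%N) ->
  logn p (\prod_(i | P i) F i)%N = (\sum_(i | P i) logn p (F i))%N.
Proof.
move=> F0; suff : (0 < \prod_(i | P i) F i)%N /\
    logn p (\prod_(i | P i) F i)%N = (\sum_(i | P i) logn p (F i))%N by case.
elim/big_rec2: _ => [|i s m /F0 Fi [m0 <-]]; first by rewrite logn1.
by rewrite muln_gt0 Fi m0 lognM.
Qed.

Lemma modn_mul_cancel q e l l' : coprime q e ->
  (e * l = e * l' %[mod q] -> l = l' %[mod q])%N.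
Proof.
move=> cop; wlog le : l l' / (l' <= l)%N => [H E|/eqP].
  by have [/H|/ltnW /H] := leqP l' l; [apply | move=> H'; apply/esym/H'].
rewrite eqn_mod_dvd ?leq_mul2l ?le ?orbT // -mulnBr Gauss_dvdr // => qd.
by apply/eqP; rewrite eqn_mod_dvd.
Qed.

(** Up to sign, [x / y] is the [q]th power of a rational number. *)
Definition same_class (q : nat) (x y : int) : Prop :=
  [/\ x != 0, y != 0 & forall p, logn p `|x| = logn p `|y| %[mod q]].

Section CountDependent.
Variables (q k : nat) (X : {fset int}) (L : nat).
Hypothesis prq : prime q.
Hypothesis class_bound : forall x0 : X, (#|[set x : X | `[< same_class q (val x) (val x0) >]]| <= L)%N.

(** Each relation fixes [e i] times the valuation of the [i]th entry modulo [q] in terms of the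
    common entries, and [e i] is invertible modulo [q]. *)
Lemma dependent_class (t t' : {ffun 'I_k -> X}) (e : {ffun 'I_k -> 'F_q}) i m m' :
  e i != 0 -> (forall j, val (t j) != 0) -> (forall j, val (t' j) != 0) ->
  (forall j, j != i -> t' j = t j) ->
  m ^+ q = kummer_prod (fun j => val (t j)) e -> m' ^+ q = kummer_prod (fun j => val (t' j)) e ->
  same_class q (val (t' i)) (val (t i)).
Proof.
move=> ei t0 t0' tt mE mE'; split=> // p; have q0 := prime_gt0 prq.
pose B := (\sum_(j | j != i) logn p (`|val (t j)| ^ (e j : nat)))%N.
have lg (s : {ffun 'I_k -> X}) (c : int) : (forall j, val (s j) != 0) -> (forall j, j != i -> s j = t j) ->
    c ^+ q = kummer_prod (fun j => val (s j)) e ->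
    (q %| (e i : nat) * logn p `|val (s i)| + B)%N.
  move=> s0 st E.
  have : (q %| logn p `|kummer_prod (fun j => val (s j)) e|)%N.
    by rewrite -E abszX lognX dvdn_mulr.
  suff -> : logn p `|kummer_prod (fun j => val (s j)) e| =
     ((e i : nat) * logn p `|val (s i)| + B)%N by [].
  rewrite /kummer_prod (big_morph absz abszM (erefl _)) logn_prodn; last first.
    by move=> j _; rewrite abszX expn_gt0 absz_gt0 s0.
  rewrite (bigD1 i) //= abszX lognX; congr (_ + _)%N.
  by apply: eq_bigr => j ji; rewrite abszX st.
have h := lg t m t0 (fun _ _ => erefl) mE; have h' := lg t' m' t0' tt mE'.
have cop : coprime q (e i : nat).
  rewrite prime_coprime //; apply: contra ei => qe.
  have : (e i < q)%N by have := ltn_ord (e i); rewrite [X in (_ < X)%N](Fp_cast prq).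
  case: (posnP (e i : nat)) => [e0 _|e0 lt]; first by apply/eqP/val_inj.
  by move: (dvdn_leq e0 qe); rewrite leqNgt lt.
apply: (modn_mul_cancel cop); apply/eqP; rewrite -(eqn_modDr B).
by move: h h'; rewrite /dvdn => /eqP -> /eqP ->.
Qed.

(** An enumeration of a counted set satisfies a relation with exponents [e != 0]. Choose [e] and an
    index [i] with [e i != 0]; once the other entries are fixed, the [i]th one is 0 or lies in a
    single class, which leaves [L.+1] values. *)
Lemma count_S_dependent : (count_S q k X <= q ^ k * k * (L.+1 * #|` X| ^ k.-1))%N.
Proof.
pose dep (t : {ffun 'I_k -> X}) (e : {ffun 'I_k -> 'F_q}) :=
  exists m : int, m ^+ q = kummer_prod (fun j => val (t j)) e.
pose W (z : {ffun 'I_k -> 'F_q} * 'I_k) := [set t : {ffun 'I_k -> X} |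
  (val (t z.2) == 0) || [&& z.1 z.2 != 0, [forall j, val (t j) != 0] & `[< dep t z.1 >]]].
have cW z : z \in [set: {ffun 'I_k -> 'F_q} * 'I_k] -> (#|W z| <= L.+1 * #|` X| ^ k.-1)%N.
  move=> _; rewrite cardfE.
  apply: (@card_fiber_bound _ _ z.2) => t tW.
  set Im := [set _ | _ in _].
  pose Z0 := [set x : X | val x == 0].
  have cZ0 : (#|Z0| <= 1)%N.
    apply/card_le1_eqP => x y; rewrite !inE => /eqP x0 /eqP y0.
    by apply: val_inj; rewrite x0 y0.
  have [E0|[x1]] := finset.set_0Vmem (Im :\: Z0).
    apply: (@leq_trans #|Z0|); last exact: leq_trans cZ0 _.
    by apply/subset_leq_card; rewrite -finset.setD_eq0 E0.
  rewrite inE => /andP [x1n /imsetP [t1]]; rewrite inE => /andP [t1W /forallP t1t] x1E.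
  have W2 t2 : t2 \in W z -> val (t2 z.2) != 0 ->
      [/\ z.1 z.2 != 0, forall j, val (t2 j) != 0 & dep t2 z.1].
    rewrite inE => /orP [/eqP -> /eqP //|/and3P [h1 /forallP h2 /asboolP h3] _].
    by split.
  have x1n' : val (t1 z.2) != 0 by move: x1n; rewrite x1E inE.
  have [ei t1n [m1 m1E]] := W2 t1 t1W x1n'.
  apply: (@leq_trans #|Z0 :|: [set x : X | `[< same_class q (val x) (val x1) >]]|).
    apply/subset_leq_card/fintype.subsetP => _ /imsetP [t2 + ->]; rewrite inE => /andP [t2W /forallP t2t].
    rewrite !inE; case: (boolP (val (t2 z.2) == 0)) => //= t2n.
    have [_ t2n' [m2 m2E]] := W2 t2 t2W t2n.
    apply/asboolP; rewrite x1E; apply: (dependent_class ei t1n t2n' _ m1E m2E) => j jz.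
    by move: (t1t j) (t2t j); rewrite jz /= => /eqP -> /eqP ->.
  by apply: leq_trans (leq_card_setU _ _) _; rewrite -add1n leq_add.
pose B := [set t : {ffun 'I_k -> X} | [exists z, t \in W z]].
pose img (t : {ffun 'I_k -> X}) : {fset int} := seq_fset tt [seq val (t j) | j <- enum 'I_k].
have sub : [fset A in fpowerset X | `[< S_qk q k A >]] `<=`
   seq_fset tt [seq img t | t <- enum B].
  apply/fsubsetP => A; rewrite !inE fpowersetE => /andP [/fsubsetP AX /asboolP [Ak Aae]].
  have H (i : 'I_k) : nth 0 (enum_fset A) i \in X.
    by apply: AX; apply: mem_nth; rewrite Ak.
  pose t : {ffun 'I_k -> X} := [ffun i => [` H i]].
  have tE i : val (t i) = nth 0 (enum_fset A) i by rewrite ffunE.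
  have [e [e0 [m mE]]] : exists e : {ffun 'I_k -> 'F_q}, e != 0 /\ dep t e.
    apply: contrapT => no; apply: (@independent_not_ae q k (fun j => val (t j)) A) => //.
      by move=> e e0 m mE; apply: no; exists e; split=> //; exists m.
    move=> z zA; have zk : (index z (enum_fset A) < k)%N by rewrite -Ak index_mem.
    by exists (Ordinal zk); rewrite tE /= nth_index.
  rewrite seq_fsetE; apply/mapP; exists t; last first.
    apply/fsetP => z; rewrite seq_fsetE; apply/idP/mapP => [zA|[j _ ->]]; last first.
      by rewrite tE mem_nth // Ak.
    have zk : (index z (enum_fset A) < k)%N by rewrite -Ak index_mem.
    by exists (Ordinal zk); rewrite ?mem_enum // tE /= nth_index.
  rewrite mem_enum inE; apply/existsP.
  (* A tuple with a zero entry is filed under the index of that entry. *)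
  case: (boolP [forall j, val (t j) != 0]) => [tn|]; last first.
    rewrite negb_forall => /existsP [j]; rewrite negbK => tj.
    by exists (e, j); rewrite inE /= tj.
  have [i ei] : exists i, e i != 0.
    apply/existsP; apply: contraR e0; rewrite negb_exists => /forallP en.
    by apply/eqP/ffunP => i; rewrite ffunE; apply/eqP; have := en i; rewrite negbK.
  exists (e, i); rewrite inE /= ei tn /=; apply/orP; right.
  by apply/asboolP; exists m.
apply: leq_trans (fsubset_leq_card sub) _.
rewrite size_seq_fset; apply: leq_trans (size_undup _) _; rewrite size_map -cardE.
apply: leq_trans (card_union_bound (R := W) (B := [set: {ffun 'I_k -> 'F_q} * 'I_k]) _ cW) _.
  by move=> t; rewrite inE => /existsP [z tz]; exists z.
by rewrite cardsT card_prod card_ffun card_Fp // !card_ord mulnC.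
Qed.

End CountDependent.


(** * Sizes of the classes in the two boxes *)

Lemma card_class_bound (X : {fset int}) q (x0 : X) (T : finType) (h : X -> T) :
  (forall x y : X, same_class q (val x) (val x0) -> same_class q (val y) (val x0) ->
     h x = h y -> `|val x|%N = `|val y|%N) ->
  (#|[set x : X | `[< same_class q (val x) (val x0) >]]| <= 2 * #|T|)%N.
Proof.
move=> hI; pose g (x : X) := ((0 < val x)%R, h x).
rewrite -(card_in_imset (f := g)); last first.
  move=> x y; rewrite !finset.in_set => /asboolP cx /asboolP cy [sg /(hI _ _ cx cy) E].
  apply: val_inj; case: cx cy => x0' _ _ [y0' _ _]; move: sg E x0' y0'.
  by rewrite /=; move: (fsval x) (fsval y) => [m|m] [n|n] /=; lia.
by apply: leq_trans (max_card _) _; rewrite card_prod card_bool.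
Qed.

Lemma add_box_le N x : x \in add_box N -> (`|x| <= N)%N.
Proof.
move=> /imfsetP [i + ->]; rewrite -[in_mem i _]/(i \in iota 0 (2 * N).+1) mem_iota; lia.
Qed.

Lemma card_add_box N : (#|` add_box N| <= (2 * N).+1)%N.
Proof.
apply: leq_trans (leq_imfset_card _ _ _) _.
by apply: (leq_trans (size_undup (iota 0 (2 * N).+1))); rewrite size_iota.
Qed.

(** Write [|x| = m ^ q * r] with [r] free of [q]th powers. The class determines [r], and [m] is at
    most [s]; the factor 2 is for the sign. *)
Lemma add_class_bound N q s (x0 : add_box N) : (0 < q)%N -> (N < s.+1 ^ q)%N ->
  (#|[set x : add_box N | `[< same_class q (val x) (val x0) >]]| <= 2 * s.+1)%N.
Proof.
move=> q0 Ns; rewrite -[X in (_ <= 2 * X)%N]card_ord.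
(* At indices that are not prime [logn] is 0, so those factors are 1. *)
pose mq (c : nat) := (\prod_(0 <= p < N.+1) p ^ (logn p c %/ q))%N.
pose rq (c : nat) := (\prod_(0 <= p < N.+1) p ^ (logn p c %% q))%N.
have cE c : (0 < c)%N -> (c <= N)%N -> c = (mq c ^ q * rq c)%N.
  move=> c0 cN; rewrite -[LHS](partnT c0) (widen_partn _ cN).
  rewrite /mq (big_morph (expn ^~ q) (fun a b => expnMn a b q) (exp1n q)) -big_split /=; apply: eq_bigr => p _.
  by rewrite -expnM -expnD -divn_eq.
have mqs c : (0 < c)%N -> (c <= N)%N -> (mq c < s.+1)%N.
  move=> c0 cN; rewrite -(ltn_exp2r _ _ q0); apply: leq_ltn_trans Ns.
  have Ec := cE c c0 cN.
  have r0 : (0 < rq c)%N by move: c0; rewrite {1}Ec muln_gt0 => /andP [].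
  by apply: leq_trans (leq_pmulr _ r0) _; rewrite -Ec.
apply: (@card_class_bound _ _ _ _ (fun x : add_box N => inord (mq `|val x|%N) : 'I_s.+1)).
move=> x y [xn _ cx] [yn _ cy] /(congr1 val).
have xN := add_box_le (valP x); have yN := add_box_le (valP y).
rewrite /= !inordK ?mqs ?absz_gt0 // => E.
have x1 : (0 < `|val x|)%N by rewrite absz_gt0.
have y1 : (0 < `|val y|)%N by rewrite absz_gt0.
rewrite [LHS](cE _ x1 xN) [RHS](cE _ y1 yN) E; congr (_ * _)%N.
by apply: eq_bigr => p _; rewrite cx cy.
Qed.

Lemma nth_prime_prime i : prime (nth_prime i).
Proof.
by case: i => //= i; rewrite /next_prime; case: ex_minnP => p /andP [].
Qed.

Lemma nth_prime_inj : injective nth_prime.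
Proof.
have step i : (nth_prime i < nth_prime i.+1)%N.
  by rewrite /= /next_prime; case: ex_minnP => p /andP [].
have mono i j : (i < j)%N -> (nth_prime i < nth_prime j)%N.
  move=> ij; rewrite -(subnKC ij); elim: (j - i.+1)%N => [|m IH]; first by rewrite addn0.
  by apply: ltn_trans IH _; rewrite addnS.
move=> i j E; case: (ltngtP i j) => // /mono; by rewrite E ltnn.
Qed.

Lemma absz_mul_elt N (x : bool * {ffun 'I_N -> 'I_N.+1}) :
  `|mul_elt x|%N = (\prod_(i < N) nth_prime i ^ x.2 i)%N.
Proof.
rewrite /mul_elt abszM abszX abszN exp1n mul1n (big_morph absz abszM (erefl _)).
by apply: eq_bigr => i _; rewrite abszX.
Qed.

Lemma logn_mul_elt N (x : bool * {ffun 'I_N -> 'I_N.+1}) (i : 'I_N) :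
  logn (nth_prime i) `|mul_elt x| = x.2 i.
Proof.
rewrite absz_mul_elt logn_prodn => [|j _]; last by rewrite expn_gt0 prime_gt0 ?nth_prime_prime.
rewrite (bigD1 i) //= lognX logn_prime ?nth_prime_prime // eqxx muln1 big1 ?addn0 // => j ji.
rewrite lognX logn_prime ?nth_prime_prime // (inj_eq nth_prime_inj).
by rewrite eq_sym val_eqE (negPf ji) muln0.
Qed.

Lemma mul_boxP N z : z \in mul_box N -> exists x, z = mul_elt (N := N) x.
Proof. by move=> /imfsetP [x _ ->]; exists x. Qed.

Lemma card_mul_box N : (#|` mul_box N| <= 2 * N.+1 ^ N)%N.
Proof.
apply: leq_trans (leq_imfset_card _ _ _) _.
apply: (leq_trans (size_undup (enum [set: bool * {ffun 'I_N -> 'I_N.+1}]))).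
rewrite -cardE cardsT card_prod card_bool.
by rewrite card_ffun !card_ord.
Qed.

(** The class fixes each of the [N] exponents modulo [q]; only their quotients by [q], at most
    [N %/ q], remain free. *)
Lemma mul_class_bound N q (x0 : mul_box N) : (0 < q)%N ->
  (#|[set x : mul_box N | `[< same_class q (val x) (val x0) >]]| <= 2 * (N %/ q).+1 ^ N)%N.
Proof.
move=> q0.
have -> : ((N %/ q).+1 ^ N)%N = #|{: {ffun 'I_N -> 'I_(N %/ q).+1}}|.
  by rewrite card_ffun !card_ord.
apply: (@card_class_bound _ _ _ _ (fun x : mul_box N =>
  [ffun i : 'I_N => inord (logn (nth_prime i) `|val x|%N %/ q) : 'I_(N %/ q).+1])).
move=> x y [_ _ cx] [_ _ cy] /ffunP E.
have [u uE] := mul_boxP (valP x); have [v vE] := mul_boxP (valP y).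
have lE i : (u.2 i : nat) = v.2 i.
  have := congr1 val (E i); rewrite !ffunE /= uE vE !logn_mul_elt.
  have lt (w : 'I_N.+1) : (w %/ q < (N %/ q).+1)%N by rewrite ltnS leq_div2r // -ltnS.
  rewrite !inordK // => Ed.
  have Em : u.2 i = v.2 i %[mod q].
    by have := cx (nth_prime i); rewrite -(cy (nth_prime i)) uE vE !logn_mul_elt.
  by rewrite (divn_eq (u.2 i) q) (divn_eq (v.2 i) q) Ed Em.
by rewrite uE vE !absz_mul_elt; apply: eq_bigr => i _; rewrite lE.
Qed.

End DependentSets.

(** * The explicit bounds and the densities *)

Lemma exp_sub_le_ffact n k : ((n - k) ^ k <= n ^_ k)%N.
Proof.
elim: k n => [|k IH] n; first by rewrite expn0 ffactn0.
case: n => [|n]; first by rewrite exp0n.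
by rewrite expnS ffactnS leq_mul ?leq_subr //= subSS IH.
Qed.

Lemma exp_le_bin B n k : (B + k <= n)%N -> (B ^ k <= 'C(n, k) * k`!)%N.
Proof.
move=> Bn; rewrite bin_ffact; apply: leq_trans (exp_sub_le_ffact n k).
by case: k Bn => // k Bn; rewrite leq_exp2r // leq_subRL //; lia.
Qed.

Section FinalBounds.
Variables (R : realType) (q k : nat).
Hypothesis prq : prime q.

Lemma count_add_bound : exists a : R, 0 < a /\ forall N : nat, (1 <= N)%N ->
  (count_S q k (add_box N))%:R <= a * (N%:R `^ (k%:R - (1 - q%:R^-1))).
Proof.
have q0 := prime_gt0 prq.
(* The 5 bounds [2 * s.+1 + 1] by a multiple of the [q]th root of [N], the 3 comes from
   [2 * N + 1 <= 3 * N], and the added 1 keeps the constant positive when [k = 0]. *)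
exists ((q ^ k * k * (5 * 3 ^ k.-1))%N%:R + 1); split; first by rewrite ltr_wpDl.
move=> N N1; have [l [l0 [h1 h2]]] := exists_root q0 (isT : (0 < 1)%N) (ltn0Sn N).
rewrite mul1n ltnS in h1; rewrite mul1n -(prednK l0) in h2.
move: (l.-1) h1 h2 => s sN Ns.
have := count_S_dependent k prq (fun x0 => add_class_bound x0 q0 Ns).
case: k => [|k'] cnt.
  by move: cnt; rewrite muln0 mul0n leqn0 => /eqP ->; rewrite mulr_ge0 ?powR_ge0 // addr_ge0.
have NR : 0 < N%:R :> R by rewrite ltr0n.
have E : N%:R `^ (k'.+1%:R - (1 - q%:R^-1)) = N%:R ^+ k' * N%:R `^ q%:R^-1 :> R.
  have -> : k'.+1%:R - (1 - q%:R^-1) = k'%:R + q%:R^-1 :> R by rewrite -natr1; lra.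
  by rewrite powRD ?powR_mulrn ?ltW // (gt_eqF NR) implybT.
set rho : R := N%:R `^ q%:R^-1 in E *.
have rho1 : 1 <= rho.
  have : (1 : R) `^ q%:R^-1 <= rho by apply: ge0_ler_powR; rewrite ?nnegrE ?invr_ge0 ?ler1n.
  by rewrite powR1.
have srho : s%:R <= rho.
  have -> : s%:R = (s%:R ^+ q) `^ q%:R^-1 :> R.
    by rewrite -powR_mulrn // -powRrM mulfV ?powRr1 // pnatr_eq0 -lt0n.
  by apply: ge0_ler_powR; rewrite ?nnegrE ?invr_ge0 ?exprn_ge0 // -natrX ler_nat.
rewrite E mulrA; apply: (@le_trans _ _ ((q ^ k'.+1 * k'.+1 * (5 * 3 ^ k'))%N%:R * N%:R ^+ k' * rho)); last first.
  by rewrite !ler_wpM2r ?powR_ge0 ?exprn_ge0 // lerDl.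
apply: (@le_trans _ _ (q ^ k'.+1 * k'.+1 * ((2 * s.+1).+1 * (3 * N) ^ k'))%N%:R).
  rewrite ler_nat; apply: leq_trans cnt _; rewrite !leq_mul2l /=.
  apply/orP; right.
  case: k' {E} => // k'; rewrite leq_exp2r //; apply: leq_trans (card_add_box N) _; lia.
rewrite expnMn !natrM -!mulrA ler_wpM2l // ler_wpM2l // !natrX.
have -> : 5 * (3 ^+ k' * (N%:R ^+ k' * rho)) = (5 * rho) * (3 ^+ k' * N%:R ^+ k') by ring.
rewrite ler_wpM2r ?mulr_ge0 ?exprn_ge0 //.
by rewrite -natr1 natrM -natr1; lra.
Qed.

Lemma add_density_zero :
  ((fun N : nat => (count_S q k (add_box N))%:R / ('C((2 * N).+1, k))%:R : R)
    @ \oo --> (0 : R))%classic.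
Proof.
have [a [a0 Ha]] := count_add_bound.
have q1 : 1 < q%:R :> R by rewrite ltr1n prime_gt1.
have d0 : 0 < 1 - q%:R^-1 :> R by rewrite subr_gt0 invf_lt1 //; lra.
set del := 1 - q%:R^-1 in d0 Ha.
apply/cvgrPdist_lt => eps e0.
have [x0 [x00 Hx]] := ln_nat_large (a * k`!%:R / eps / del).
exists (x0 + k)%N => // N /= NN; rewrite sub0r normrN ger0_norm ?divr_ge0 //.
have N1 : (1 <= N)%N by lia.
have NR : 0 < N%:R :> R by rewrite ltr0n.
have hb : N%:R ^+ k <= 'C((2 * N).+1, k)%:R * k`!%:R :> R.
  by rewrite -natrX -natrM ler_nat exp_le_bin //; lia.
have C0 : 0 < 'C((2 * N).+1, k)%:R :> R by rewrite ltr0n bin_gt0; lia.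
rewrite ltr_pdivrMr //; apply: le_lt_trans (Ha N N1) _.
rewrite powRB; last by rewrite (gt_eqF NR) implybT.
rewrite powR_mulrn ?ltW //.
have Nd : 0 < N%:R `^ del :> R by rewrite powR_gt0.
rewrite mulrA ltr_pdivrMr //.
(* The power is [expR (del * ln N)], which exceeds [del * ln N]. *)
have big : a * k`!%:R / eps < N%:R `^ del.
  rewrite /powR gt_eqF //; apply: lt_le_trans (expR_ge1Dx _).
  have := Hx N ltac:(lia); rewrite ler_pdivrMr // mulrC; lra.
rewrite ltr_pdivrMr // in big.
apply: (@le_lt_trans _ _ (a * ('C((2 * N).+1, k)%:R * k`!%:R))); first by rewrite ler_wpM2l // ltW.
have -> : a * ('C((2 * N).+1, k)%:R * k`!%:R) = (a * k`!%:R) * 'C((2 * N).+1, k)%:R :> R by ring.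
have -> : eps * 'C((2 * N).+1, k)%:R * N%:R `^ del = (N%:R `^ del * eps) * 'C((2 * N).+1, k)%:R by ring.
by rewrite ltr_pM2r.
Qed.

Lemma expD_le (c N : nat) : (N + c)%:R ^+ N <= expR c%:R * N%:R ^+ N :> R.
Proof.
case: N => [|N]; first by rewrite !expr0 mulr1; apply: le_trans (expR_ge1Dx _); rewrite lerDl.
have NR : 0 < N.+1%:R :> R by rewrite ltr0n.
have -> : (N.+1 + c)%:R = (1 + c%:R / N.+1%:R) * N.+1%:R :> R.
  by rewrite mulrDl mul1r mulfVK ?gt_eqF // natrD.
rewrite exprMn ler_wpM2r ?exprn_ge0 //.
apply: (@le_trans _ _ (expR (c%:R / N.+1%:R) ^+ N.+1)).
  by rewrite lerXn2r ?nnegrE ?expR_ge0 ?expR_ge1Dx // addr_ge0 // divr_ge0.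
by rewrite -expRM_natr mulfVK ?gt_eqF.
Qed.

(** By [(1 + c / N) ^ N <= expR c], a class has [O(N ^ N / q ^ N)] elements and the box [O(N ^ N)];
    the one dependent entry contributes the saving [q ^ N]. *)
Lemma count_mul_bound : exists m : R, 0 < m /\ forall N : nat,
  (count_S q k (mul_box N))%:R <= m * (N%:R ^+ (N * k) / q%:R ^+ N).
Proof.
have q0 := prime_gt0 prq; have qR : 0 < q%:R :> R by rewrite ltr0n.
exists ((q ^ k * k)%N%:R * (3 * expR q%:R) * (2 * expR 1) ^+ k.-1 + 1).
have m0 : 0 <= (q ^ k * k)%N%:R * (3 * expR q%:R) * (2 * expR 1) ^+ k.-1 :> R.
  by rewrite !mulr_ge0 ?exprn_ge0 ?mulr_ge0 ?expR_ge0.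
split; first by rewrite ltr_wpDl.
move=> N; have := count_S_dependent k prq (fun x0 : mul_box N => mul_class_bound x0 q0).
have NN0 : 0 <= N%:R ^+ (N * k) / q%:R ^+ N :> R by rewrite divr_ge0 ?exprn_ge0.
case: k m0 NN0 => [|k'] m0 NN0 cnt.
  by move: cnt; rewrite muln0 mul0n leqn0 => /eqP ->; rewrite mulr_ge0 ?addr_ge0.
rewrite mulrDl mul1r -[X in X <= _]addr0; apply: lerD => //=.
apply: (@le_trans _ _ (q ^ k'.+1 * k'.+1 * ((3 * (N %/ q).+1 ^ N) * (2 * N.+1 ^ N) ^ k'))%N%:R).
  rewrite ler_nat; apply: leq_trans cnt _; rewrite leq_mul2l; apply/orP; right.
  apply: leq_mul; first by have : (0 < (N %/ q).+1 ^ N)%N; [rewrite expn_gt0 | lia].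
  by case: k' {m0 NN0} => // k'; rewrite leq_exp2r // card_mul_box.
have h1 : ((N %/ q).+1 ^ N)%N%:R <= expR q%:R * (N%:R ^+ N / q%:R ^+ N) :> R.
  rewrite mulrA ler_pdivlMr ?exprn_gt0 //; apply: le_trans (expD_le q N).
  rewrite -!natrX -natrM ler_nat -expnMn; case: (N) => // N'; rewrite leq_exp2r //.
  by rewrite mulSn addnC leq_add2r leq_trunc_div.
have h2 : (N.+1 ^ N)%N%:R <= expR 1 * N%:R ^+ N :> R.
  by have := expD_le 1 N; rewrite addn1 natrX.
have -> : (N%:R ^+ (N * k'.+1) : R) = N%:R ^+ N * (N%:R ^+ N) ^+ k'.
  by rewrite mulnS exprD exprM.
have h3 : ((2 * N.+1 ^ N) ^ k')%N%:R <= (2 * expR 1) ^+ k' * (N%:R ^+ N) ^+ k' :> R.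
  rewrite natrX -exprMn lerXn2r ?nnegrE ?mulr_ge0 ?expR_ge0 ?exprn_ge0 //.
  by rewrite natrM -mulrA ler_wpM2l.
have -> : (q ^ k'.+1 * k'.+1)%N%:R * (3 * expR q%:R) * (2 * expR 1) ^+ k' *
   (N%:R ^+ N * (N%:R ^+ N) ^+ k' / q%:R ^+ N) =
   (q ^ k'.+1 * k'.+1)%N%:R * ((3 * (expR q%:R * (N%:R ^+ N / q%:R ^+ N))) *
    ((2 * expR 1) ^+ k' * (N%:R ^+ N) ^+ k')) :> R by ring.
rewrite natrM ler_wpM2l // natrM; apply: ler_pM => //.
by rewrite natrM ler_wpM2l.
Qed.

Lemma mul_density_zero :
  ((fun N : nat => (count_S q k (mul_box N))%:R / ('C(2 * (N.+1 ^ N), k))%:R : R)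
    @ \oo --> (0 : R))%classic.
Proof.
have [m [m0 Hm]] := count_mul_bound.
have q1 : (1 < q)%N := prime_gt1 prq.
apply/cvgrPdist_lt => eps e0.
pose B := Num.bound (m * k`!%:R / eps).
have HB : m * k`!%:R / eps < B%:R by apply: archi_boundP; rewrite divr_ge0 ?mulr_ge0 // ltW.
exists (B + k).+1 => // N /= NN; rewrite sub0r normrN ger0_norm ?divr_ge0 //.
have kN : (k <= N.+1 ^ N)%N.
  apply: (@leq_trans (N.+1 ^ 1)%N); first by rewrite expn1; lia.
  by rewrite leq_exp2l //; lia.
(* One copy of [N.+1 ^ N] dominates [N ^ N], the other dominates [k]; this gives
   [N ^ (N * k) <= 'C(2 * N.+1 ^ N, k) * k!]. *)
have NB : (N ^ N + k <= 2 * N.+1 ^ N)%N.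
  by rewrite mul2n -addnn leq_add //; case: (N) => // N'; rewrite leq_exp2r.
have hb : N%:R ^+ (N * k) <= 'C(2 * N.+1 ^ N, k)%:R * k`!%:R :> R.
  by rewrite -natrX -natrM ler_nat expnM exp_le_bin.
have C0 : 0 < 'C(2 * N.+1 ^ N, k)%:R :> R by rewrite ltr0n bin_gt0; lia.
have Q0 : 0 < q%:R ^+ N :> R by rewrite exprn_gt0 // ltr0n ltnW.
rewrite ltr_pdivrMr //; apply: le_lt_trans (Hm N) _.
rewrite mulrA ltr_pdivrMr //.
have big : m * k`!%:R / eps < q%:R ^+ N.
  apply: lt_le_trans HB _; rewrite -natrX ler_nat; apply: leq_trans (ltnW (ltn_expl N q1)); lia.
rewrite ltr_pdivrMr // in big.
apply: (@le_lt_trans _ _ (m * ('C(2 * N.+1 ^ N, k)%:R * k`!%:R))); first by rewrite ler_wpM2l // ltW.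
have -> : m * ('C(2 * N.+1 ^ N, k)%:R * k`!%:R) = (m * k`!%:R) * 'C(2 * N.+1 ^ N, k)%:R :> R by ring.
have -> : eps * 'C(2 * N.+1 ^ N, k)%:R * q%:R ^+ N = (q%:R ^+ N * eps) * 'C(2 * N.+1 ^ N, k)%:R by ring.
by rewrite ltr_pM2r.
Qed.

End FinalBounds.

Theorem theorem1 (q k : nat) : prime q ->
  add_subset_density q k 0 /\
  (exists a : RR, 0 < a /\
     forall N : nat, (1 <= N)%N ->
       (count_S q k (add_box N))%:R <= a * (N%:R `^ (k%:R - (1 - q%:R^-1)))) /\
  mul_subset_density q k 0 /\
  (exists m : RR, 0 < m /\
     forall N : nat,
       (count_S q k (mul_box N))%:R <= m * (N%:R ^+ (N * k) / q%:R ^+ N)).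
Proof.
move=> prq; split; [exact: add_density_zero | split; [exact: count_add_bound |]].
by split; [exact: mul_density_zero | exact: count_mul_bound].
Qed.
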